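(* Let $S=\{\mathbf{x}\in\mathbb{R}^n: g_j(\mathbf{x})\ge 0,\ j=1,\dots,m\}$ with $g_1,\dots,g_m\in\mathbb{R}[\mathbf{x}]$ be compact with nonempty interior, let $g_0=1$ and $G=\{g_0,g_1,\dots,g_m\}$. Fix $t\in\mathbb{N}$ and consider the two convex optimization problems $$\rho_t=\inf_{\boldsymbol{\phi}_{2t}}\Big\{-\sum_{g\in G_t}\log\det\big(\mathbf{M}_{t-t_g}(g\cdot\boldsymbol{\phi}_{2t})\big):\ \phi_{2t}(1)=1;\ \mathbf{M}_{t-t_g}(g\cdot\boldsymbol{\phi}_{2t})\succeq0,\ \forall g\in G_t\Big\},$$ over $\boldsymbol{\phi}_{2t}\in\mathbb{R}^{s(2t)}$, and $$\rho^*_t=\sup_{(\mathbf{Q}_g)_{g\in G_t}}\Big\{\sum_{g\in G_t}\log\det(\mathbf{Q}_g):\ \mathbf{Q}_g\succeq0,\ \forall g\in G_t;\ \sum_{g\in G_t}s(t-t_g)=\sum_{g\in G_t}g(\mathbf{x})\,\mathbf{v}_{t-t_g}(\mathbf{x})^T\mathbf{Q}_g\mathbf{v}_{t-t_g}(\mathbf{x}),\ \forall\mathbf{x}\in\mathbb{R}^n\Big\},$$ over real symmetric matrices $\mathbf{Q}_g$ of size $s(t-t_g)$. The two problems have the same finite optimal value $\rho_t=\rho^*_t$ if and only if $1\in\mathrm{int}(Q_t(G))$. In that case both have a unique optimal solution, $\boldsymbol{\phi}^*_{2t}\in\mathbb{R}^{s(2t)}$ and $(\mathbf{Q}^*_g)_{g\in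 G_t}$ respectively, which satisfy $\mathbf{Q}^*_g=\mathbf{M}_{t-t_g}(g\cdot\boldsymbol{\phi}^*_{2t})^{-1}$ for all $g\in G_t$. Therefore, for all $\mathbf{x}\in\mathbb{R}^n$, $$1=\frac{1}{\sum_{g\in G_t}s(t-t_g)}\sum_{g\in G_t}g(\mathbf{x})\,\mathbf{v}_{t-t_g}(\mathbf{x})^T\mathbf{M}_{t-t_g}(g\cdot\boldsymbol{\phi}^*_{2t})^{-1}\mathbf{v}_{t-t_g}(\mathbf{x})=\frac{1}{\sum_{g\in G_t}s(t-t_g)}\sum_{g\in G_t}g(\mathbf{x})\,\Lambda^{g\cdot\phi^*_{2t}}_{t-t_g}(\mathbf{x})^{-1}.$$
   Context: Notation. $\mathbb{R}[\mathbf{x}]$ is the ring of real polynomials in $\mathbf{x}=(x_1,\dots,x_n)$, $\mathbb{R}[\mathbf{x}]_d$ the subspace of polynomials of degree at most $d$, and $\Sigma[\mathbf{x}]$ the convex cone of sums of squares of polynomials. For $t\in\mathbb{N}$, $\mathbb{N}^n_t=\{\boldsymbol{\alpha}\in\mathbb{N}^n:|\boldsymbol{\alpha}|\le t\}$, $s(t)=\binom{n+t}{n}=\#\mathbb{N}^n_t$, and $\mathbf{v}_t(\mathbf{x})=(\mathbf{x}^{\boldsymbol{\alpha}})_{\boldsymbol{\alpha}\in\mathbb{N}^n_t}$. For $g\in\mathbb{R}[\mathbf{x}]$, $t_g=\lceil\deg(g)/2\rceil$; $G_t=\{g\in G: t_g\le t\}$. The $2t$-truncated quadratic module is $Q_t(G)=\{\sum_{g\in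 G}\sigma_g\,g:\ \sigma_g\in\Sigma[\mathbf{x}],\ \deg(\sigma_g g)\le 2t\}\subset\mathbb{R}[\mathbf{x}]_{2t}$; $\mathrm{int}$ is the interior in the finite-dimensional space $\mathbb{R}[\mathbf{x}]_{2t}$. $\mathbf{A}\succeq0$ means positive semidefinite; $\log\det$ of a singular positive semidefinite matrix is $-\infty$. Moments. A finite sequence $\boldsymbol{\phi}_{2t}=(\phi_{\boldsymbol{\alpha}})_{\boldsymbol{\alpha}\in\mathbb{N}^n_{2t}}$ has Riesz functional $\phi_{2t}:\mathbb{R}[\mathbf{x}]_{2t}\to\mathbb{R}$, $\phi_{2t}(\sum_{\boldsymbol{\alpha}}p_{\boldsymbol{\alpha}}\mathbf{x}^{\boldsymbol{\alpha}})=\sum_{\boldsymbol{\alpha}}p_{\boldsymbol{\alpha}}\phi_{\boldsymbol{\alpha}}$. For $g\in G_t$, $\mathbf{M}_{t-t_g}(g\cdot\boldsymbol{\phi}_{2t})$ is the matrix indexed by $\mathbb{N}^n_{t-t_g}$ with entries $\phi_{2t}(g\,\mathbf{x}^{\boldsymbol{\alpha}+\boldsymbol{\beta}})$. When it is positive definite, $\Lambda^{g\cdot\phi_{2t}}_{t-t_g}$ (Christoffel function) is defined by $\Lambda^{g\cdot\phi_{2t}}_{t-t_g}(\mathbf{x})^{-1}=\mathbf{v}_{t-t_g}(\mathbf{x})^T\mathbf{M}_{t-t_g}(g\cdot\boldsymbol{\phi}_{2t})^{-1}\mathbf{v}_{t-t_g}(\mathbf{x})$. *)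

(* Defs.v *)
From HB Require Import structures.
From mathcomp Require Import all_boot all_order all_algebra finmap.
From mathcomp Require Import all_classical all_reals all_analysis.
(* The notations of mpoly clash with those of mathcomp-analysis: we import the
   file without them and redefine the few that we need. *)
From mathcomp Require Export -(notations) mpoly.

Set Implicit Arguments.
Unset Strict Implicit.
Unset Printing Implicit Defensive.

Import Order.TTheory GRing.Theory Num.Theory.
Import numFieldNormedType.Exports.
Local Open Scope classical_set_scope.
Local Open Scope fset_scope.
Local Open Scope ring_scope.

Notation "{ 'mpoly' T [ n ] }" := (mpoly n T)
  (at level 0, T, n at level 2, format "{ 'mpoly'  T [ n ] }") : type_scope.
Notation "p @_ m" := (mcoeff m p)
  (at level 3, m at level 2, left associativity, format "p @_ m") : ring_scope.

Section Monomials.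
Variables (R : realType) (n : nat).
Implicit Types (p : {mpoly R[n]}) (x : 'rV[R]_n).

(* The multi-indices of N^n_d form the finite type bmultinom n d.+1, whose
   elements have total degree < d.+1. *)
Definition nmonom (d : nat) : nat := #|{: bmultinom n d.+1}|.

Lemma nmonomE (d : nat) : nmonom d = 'C(n + d, n).
Proof.
rewrite -card_partial_ord_partitions /nmonom.
have mltd (a : bmultinom n d.+1) (i : 'I_n) : (bmnm a i < d.+1)%N.
  apply: leq_ltn_trans (bmdeg a); rewrite mdegE (bigD1 i) //=.
  exact: leq_addr.
pose f (a : bmultinom n d.+1) : n.-tuple 'I_d.+1 :=
  [tuple Ordinal (mltd a i) | i < n].
have f_inj : injective f.
  move=> a b /(congr1 (fun u i => tnth u i)) fab.
  apply/val_inj/mnmP => i.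
  have /(congr1 val) := congr1 (fun h : 'I_n -> _ => h i) fab.
  by rewrite !tnth_mktuple.
rewrite -(card_imset _ f_inj); apply: eq_card => u.
have degE (v : n.-tuple 'I_d.+1) :
    (\sum_(i <- v) i = \sum_(i < n) (tnth v i : nat))%N by rewrite big_tuple.
apply/imsetP/idP => [[a _ ->]|].
  rewrite inE degE; under eq_bigr do rewrite tnth_mktuple /=.
  by rewrite -mdegE -ltnS bmdeg.
rewrite inE degE => degu.
pose a0 : multinom n := Multinom [tuple (tnth u i : nat) | i < n].
have a0E i : a0 i = tnth u i :> nat.
  by rewrite multinomE tnth_mktuple.
have dega0 : (mdeg a0 < d.+1)%N.
  by rewrite mdegE ltnS; under eq_bigr do rewrite a0E.
exists (BMultinom dega0) => //; apply: eq_from_tnth => i.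
by apply: val_inj; rewrite tnth_mktuple /= a0E.
Qed.

Definition expo (d : nat) (i : 'I_(nmonom d)) : multinom n :=
  bmnm (enum_val i).

Definition peval p x : R := meval (fun i => x 0 i) p.

Definition vmonom (d : nat) x : 'cV[R]_(nmonom d) :=
  \col_i peval (mpolyX R (expo i)) x.

(* msize p = deg p + 1 for p != 0. *)
Definition mdegree p : nat := (msize p).-1.

Definition halfdeg p : nat := uphalf (mdegree p).

End Monomials.

Arguments expo {n d} i.

Section Matrices.
Variables (R : realType) (k : nat).
Implicit Types (A : 'M[R]_k) (v : 'cV[R]_k).

Definition qform A v : R := (v^T *m A *m v) 0 0.

Definition psdmx A : Prop := A^T = A /\ forall v, 0 <= qform A v.

Definition pdmx A : Prop := A^T = A /\ forall v, v != 0 -> 0 < qform A v.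

(* Only meaningful for psdmx A. *)
Definition logdet A : \bar R :=
  if \det A == 0 then -oo%E else (ln (\det A))%:E.

End Matrices.

Section QuadraticModule.
Variables (R : realType) (n : nat).
Implicit Types (p s : {mpoly R[n]}) (G : {fset {mpoly R[n]}}).

Definition sos s : Prop :=
  exists qs : seq {mpoly R[n]}, s = \sum_(q <- qs) q ^+ 2.

(* The degree bound is stated with msize so that it holds of the zero
   polynomial. *)
Definition qmodule G (t : nat) : set {mpoly R[n]} :=
  [set p | exists s : G -> {mpoly R[n]},
     (forall g : G, sos (s g) /\ (msize (s g * val g) <= (2 * t).+1)%N) /\
     p = \sum_(g : G) s g * val g].

Definition poly_of_coefs (d : nat) (c : 'rV[R]_(nmonom n d)) : {mpoly R[n]} :=
  \sum_(i < nmonom n d) c 0 i *: mpolyX R (expo i).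

(* Interior relative to R[x]_d, with the topology transported along the linear
   isomorphism poly_of_coefs from R^s(d) onto R[x]_d. *)
Definition interior_deg (d : nat) (Q : set {mpoly R[n]}) : set {mpoly R[n]} :=
  @poly_of_coefs d @` (@poly_of_coefs d @^-1` Q)°.

Definition truncG G (t : nat) : {fset {mpoly R[n]}} :=
  [fset g in G | (halfdeg g <= t)%N].

Definition constraints (m : nat) (g : 'I_m -> {mpoly R[n]}) :
    {fset {mpoly R[n]}} :=
  1 |` [fset g j | j in 'I_m].

Definition semialg (m : nat) (g : 'I_m -> {mpoly R[n]}) : set 'rV[R]_n :=
  [set x | forall j, 0 <= peval (g j) x].

End QuadraticModule.

Section Problems.
Variables (R : realType) (n : nat) (G : {fset {mpoly R[n]}}) (t : nat).

Definition riesz (d : nat) (phi : 'rV[R]_(nmonom n d)) (p : {mpoly R[n]}) : R :=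
  \sum_(i < nmonom n d) p@_(expo i) * phi 0 i.

Definition msz (g : {mpoly R[n]}) : nat := nmonom n (t - halfdeg g).

(* The matrix M_{t - t_g}(g . phi_{2t}). *)
Definition locmx (phi : 'rV[R]_(nmonom n (2 * t))) (g : {mpoly R[n]}) :
    'M[R]_(msz g) :=
  \matrix_(i, j) riesz phi (g * mpolyX R (mnm_add (expo i) (expo j))).

Definition vmon (g : {mpoly R[n]}) (x : 'rV[R]_n) : 'cV[R]_(msz g) :=
  vmonom (t - halfdeg g) x.

Definition christoffel (phi : 'rV[R]_(nmonom n (2 * t))) (g : {mpoly R[n]})
    (x : 'rV[R]_n) : R :=
  (qform (invmx (locmx phi g)) (vmon g x))^-1.

Definition total_size : nat := (\sum_(g : truncG G t) msz (val g))%N.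

Definition primal_feasible (phi : 'rV[R]_(nmonom n (2 * t))) : Prop :=
  riesz phi 1 = 1 /\ forall g : truncG G t, psdmx (locmx phi (val g)).

Definition primal_obj (phi : 'rV[R]_(nmonom n (2 * t))) : \bar R :=
  (- \sum_(g : truncG G t) logdet (locmx phi (val g)))%E.

Definition rho : \bar R :=
  ereal_inf [set primal_obj phi | phi in primal_feasible].

Definition primal_optimal (phi : 'rV[R]_(nmonom n (2 * t))) : Prop :=
  primal_feasible phi /\ primal_obj phi = rho.

Definition gram_family : Type := forall g : truncG G t, 'M[R]_(msz (val g)).

Definition dual_feasible (Q : gram_family) : Prop :=
  (forall g, psdmx (Q g)) /\
  (forall x : 'rV[R]_n, total_size%:R =
     \sum_(g : truncG G t) peval (val g) x * qform (Q g) (vmon (val g) x)).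

Definition dual_obj (Q : gram_family) : \bar R :=
  (\sum_(g : truncG G t) logdet (Q g))%E.

Definition rho_star : \bar R :=
  ereal_sup [set dual_obj Q | Q in dual_feasible].

Definition dual_optimal (Q : gram_family) : Prop :=
  dual_feasible Q /\ dual_obj Q = rho_star.

End Problems.

(* Main.v *)
Require Import Defs.
From HB Require Import structures.
From mathcomp Require Import all_boot all_order all_algebra finmap.
From mathcomp Require Import all_classical all_reals all_analysis.
From mathcomp Require Import perm ring lra zify.
Import Order.TTheory GRing.Theory Num.Theory.
Import numFieldNormedType.Exports.
Local Open Scope classical_set_scope.
Local Open Scope ring_scope.

(* If 1 lies in the interior of Q_t(G), the moments of a feasible phi are
   bounded, so the primal feasible set is compact; averages of point evaluations
   on S give a strictly feasible phi.  Hence the product of the determinants of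
   the localizing matrices attains a positive maximum.  Stationarity there says
   that every psi with psi(1) = 0 kills
     P = sum_g g v^T M(g phi)^-1 v,
   so P is constant, and pairing with phi shows P = sum_g s(t - t_g).  Thus the
   inverses M(g phi)^-1 are dual feasible, and everything else follows from
     log det A + log det B <= tr(A B) - k, with equality only if B = A^-1.
   Conversely, a dual feasible family with finite objective is positive definite,
   and perturbing the Gram matrix attached to g = 1 represents every polynomial
   of degree at most 2t that is close to 1. *)

(** * Positive definite matrices *)

Section PositiveDefinite.
Context {R : realType}.

Lemma qformE {k} (A : 'M[R]_k) (v : 'cV[R]_k) :
  qform A v = \sum_i \sum_j A i j * (v i 0 * v j 0).
Proof.
rewrite /qform -mulmxA mxE; apply: eq_bigr => i _.
by rewrite !mxE mulr_sumr; apply: eq_bigr => j _; rewrite mulrCA mulrA.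
Qed.

Lemma qformD {k} (A B : 'M[R]_k) v : qform (A + B) v = qform A v + qform B v.
Proof. by rewrite /qform mulmxDr mulmxDl mxE. Qed.

Lemma qformZ {k} c (A : 'M[R]_k) v : qform (c *: A) v = c * qform A v.
Proof. by rewrite /qform -scalemxAr -scalemxAl mxE. Qed.

Lemma qform_congr {k l} (A : 'M[R]_k) (U : 'M[R]_(k, l)) v :
  qform (U^T *m A *m U) v = qform A (U *m v).
Proof. by rewrite /qform trmx_mul !mulmxA. Qed.

Lemma pdmx_congr {k} {A U : 'M[R]_k} :
  U \in unitmx -> pdmx A -> pdmx (U^T *m A *m U).
Proof.
move=> Uu [As Ap]; split=> [|v v0]; first by rewrite !trmx_mul trmxK As mulmxA.
rewrite qform_congr; apply: Ap; apply: contra_neq v0 => Uv0.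
by rewrite -[v](mulKmx Uu) Uv0 mulmx0.
Qed.

Lemma pdmx1 {k} : pdmx (1%:M : 'M[R]_k).
Proof.
split=> [|v v0]; first by rewrite trmx1.
rewrite /qform mulmx1 mxE lt_neqAle eq_sym sumr_ge0 ?andbT; last first.
  by move=> i _; rewrite mxE -expr2 sqr_ge0.
apply: contra_neq v0 => /eqP; rewrite psumr_eq0 => [|i _]; last first.
  by rewrite mxE -expr2 sqr_ge0.
move=> /allP v0; apply/colP => i; rewrite mxE.
by move: (v0 i (mem_index_enum _)); rewrite /= mxE -expr2 sqrf_eq0 => /eqP.
Qed.

Lemma pdmx_psd {k} {A : 'M[R]_k} : pdmx A -> psdmx A.
Proof.
move=> [As Ap]; split=> // v; have [->|/Ap/ltW//] := eqVneq v 0.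
by rewrite /qform mulmx0 mxE.
Qed.

Lemma pdmxZ {k} a (A : 'M[R]_k) : 0 < a -> pdmx A -> pdmx (a *: A).
Proof.
move=> a0 [As Ap]; split=> [|v /Ap]; first by rewrite linearZ /= As.
by rewrite qformZ => Av; apply: mulr_gt0.
Qed.

(** Gaussian elimination of the first row and column: [U (- b)] inverts [U b], and congruence by it
    leaves the pivot [a] and the Schur complement [S]. The inductions on matrix size rest on
    this. *)
Lemma pdmx_schur {k} {A : 'M[R]_(1 + k)} : pdmx A ->
  exists (a : R) (b : 'rV[R]_k) (S : 'M[R]_k),
    [/\ 0 < a, pdmx S &
        A = (block_mx 1%:M b 0 1%:M)^T *m block_mx a%:M 0 0 S
              *m block_mx 1%:M b 0 1%:M].
Proof.
move=> Apd; have [As Ap] := Apd.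
pose a := A 0 0.
pose U (c : 'rV[R]_k) := block_mx (1%:M : 'M[R]_1) c 0 (1%:M : 'M[R]_k).
have a_gt0 : 0 < a.
  have := Ap (delta_mx 0 0); rewrite /qform trmx_delta -rowE -colE !mxE.
  by apply; apply/eqP => /matrixP/(_ 0 0)/eqP; rewrite !mxE !eqxx oner_eq0.
have ulE : ulsubmx A = a%:M.
  by apply/matrixP => i j; rewrite !ord1 !mxE /a mulr1n; congr (A _ _); apply/val_inj.
have dlE : dlsubmx A = (ursubmx A)^T by rewrite trmx_ursub As.
have [b urE] : exists b, ursubmx A = a *: b.
  by exists (a^-1 *: ursubmx A); rewrite scalerA divff ?scale1r // gt_eqF.
pose S := drsubmx A - a *: (b^T *m b).
have AE : A = (U b)^T *m block_mx a%:M 0 0 S *m U b.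
  rewrite tr_block_mx !trmx1 trmx0 !mulmx_block !(mulmx0, mul0mx, mulmx1, mul1mx).
  rewrite !(addr0, add0r) mul_scalar_mx mul_mx_scalar.
  rewrite -{1}[A]submxK ulE dlE urE linearZ /=; congr block_mx.
  by rewrite -scalemxAl /S addrC subrK.
have Uu c : U c \in unitmx by rewrite unitmxE det_ublock !det1 mulr1 unitr1.
have Dpd := pdmx_congr (Uu (- b)) Apd.
have DE : (U (- b))^T *m A *m U (- b) = block_mx a%:M 0 0 S.
  have UK : U b *m U (- b) = 1%:M.
    rewrite mulmx_block !(mulmx0, mul0mx, mulmx1, mul1mx) !(addr0, add0r).
    by rewrite addNr -scalar_mx_block.
  by rewrite {1}AE -!mulmxA UK mulmx1 !mulmxA -trmx_mul UK trmx1 mul1mx.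
rewrite DE in Dpd.
exists a, b, S; split=> //; have [Ds Dp] := Dpd; split=> [|v v0].
  by move: Ds; rewrite tr_block_mx => /eq_block_mx[].
have := Dp (col_mx 0 v); rewrite /qform tr_col_mx mul_row_block mul_row_col.
rewrite !(mulmx0, trmx0, mul0mx, add0r); apply.
by rewrite col_mx_eq0 negb_and v0 orbT.
Qed.

Lemma ln_le_subr1 {a : R} : 0 < a -> ln a <= a - 1 ?= iff (a == 1).
Proof.
move=> a0; have [->|a1] := eqVneq a 1; first by rewrite ln1 subrr; apply/leifP.
apply/leifP; rewrite -{2}(lnK (x := a)) //.
have : ln a != 0 by rewrite ln_eq0.
move=> /expR_gt1Dx; rewrite lnK//; lra.
Qed.

(** A Schur step splits the determinant into [a * \det S] and the trace into
    [a + \tr S + a * |b|^2], so the bound follows by induction from [ln a <= a - 1]. Equality forces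
    [a = 1], [b = 0] and [S = 1]. *)
Lemma logdet_le_trace {k} {A : 'M[R]_k} : pdmx A ->
  [/\ 0 < \det A, ln (\det A) <= \tr A - k%:R
    & ln (\det A) = \tr A - k%:R -> A = 1%:M].
Proof.
elim: k A => [|k IH] A Apd.
  rewrite det_mx00 ln1 /mxtrace big_ord0 subr0.
  by split=> // _; apply/matrixP => -[].
have [a [b [S [a_gt0 /IH[S_gt0 S_le S_eq] AE]]]] := pdmx_schur Apd.
have detA : @determinant R (1 + k) A = a * \det S.
  rewrite AE !det_mulmx det_tr !det_ublock !det1 det_scalar1.
  by rewrite !mulr1 mul1r.
have trA : @mxtrace R (1 + k) A = a + \tr S + a * \sum_i b 0 i ^+ 2.
  rewrite AE tr_block_mx !trmx1 trmx0 !mulmx_block.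
  rewrite !(mulmx0, mul0mx, mulmx1, mul1mx, addr0, add0r).
  rewrite mxtrace_block mxtraceD mxtrace_scalar mulr1n mul_mx_scalar -scalemxAl.
  rewrite mxtraceZ mxtrace_mulC trace_mx11 mxE -addrA [_ + \tr S]addrC.
  by congr (_ + (_ + _ * _)); apply: eq_bigr => i _; rewrite mxE expr2.
have b_ge0 : 0 <= \sum_i b 0 i ^+ 2 by apply: sumr_ge0 => i _; apply: sqr_ge0.
have [ln_a ln_eq] := ln_le_subr1 a_gt0.
have ab_ge0 := mulr_ge0 (ltW a_gt0) b_ge0.
rewrite detA trA lnM ?posrE // -[(k.+1)%:R]natr1; split; first exact: mulr_gt0.
  by lra.
move=> H; have a1 : a = 1 by apply/eqP; rewrite -ln_eq; apply/eqP; lra.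
have S1 : S = 1%:M by apply: S_eq; lra.
have /eqP : \sum_i b 0 i ^+ 2 = 0 by subst a; lra.
rewrite psumr_eq0 => [|i _]; last exact: sqr_ge0.
move=> /allP b0; have {b0}b0 : b = 0.
  apply/rowP => i; rewrite mxE; apply/eqP; rewrite -sqrf_eq0.
  exact: b0 (mem_index_enum _).
rewrite AE b0 a1 S1 -!scalar_mx_block trmx1 !mulmx1 //.
Qed.

(** Cholesky factorization by induction through the Schur complement, with the square root of the
    pivot on the diagonal. *)
Lemma pdmx_factor {k} {A : 'M[R]_k} : pdmx A ->
  exists2 L : 'M[R]_k, L \in unitmx & A = L^T *m L.
Proof.
elim: k A => [|k IH] A Apd.
  by exists 1%:M; [apply: unitmx1 | apply/matrixP => -[]].
have [a [b [S [a_gt0 /IH[L Lu ->] ->]]]] := pdmx_schur Apd.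
have Vu : block_mx 1%:M b 0 1%:M \in unitmx.
  by rewrite unitmxE det_ublock !det1 mulr1 unitr1.
pose D := block_mx ((Num.sqrt a)%:M : 'M[R]_1) 0 0 L.
have Du : D \in unitmx.
  rewrite unitmxE det_ublock det_scalar1 unitrM -unitmxE Lu andbT.
  by rewrite unitfE sqrtr_eq0 -ltNge.
exists (D *m block_mx 1%:M b 0 1%:M).
  by rewrite unitmx_mul Du.
rewrite trmx_mul !mulmxA -(mulmxA _ D^T D).
congr (_ *m _ *m _); rewrite /D tr_block_mx !trmx0 tr_scalar_mx mulmx_block.
rewrite !(mulmx0, mul0mx, addr0, add0r) -scalar_mxM -expr2 sqr_sqrtr //.
exact: ltW.
Qed.

Lemma pdmx_det_gt0 {k} {A : 'M[R]_k} : pdmx A -> 0 < \det A.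
Proof. by case/logdet_le_trace. Qed.

Lemma pdmx_unit {k} {A : 'M[R]_k} : pdmx A -> A \in unitmx.
Proof. by move=> /pdmx_det_gt0; rewrite unitmxE unitfE => /lt0r_neq0. Qed.

Lemma pdmx_inv {k} {A : 'M[R]_k} : pdmx A -> pdmx (invmx A).
Proof.
move=> Apd; have Au := pdmx_unit Apd; have [As _] := Apd.
have := pdmx_congr (U := invmx A) _ Apd; rewrite unitmx_inv => /(_ Au).
by rewrite trmx_inv As mulVmx // mul1mx.
Qed.

(** For [A = L^T *m L], the matrix [L *m B *m L^T] has determinant [\det A * \det B] and trace
    [\tr (A *m B)], so [logdet_le_trace] applies to it; in the equality case it is the identity. *)
Lemma logdet_mul_le_trace {k} {A B : 'M[R]_k} : pdmx A -> pdmx B ->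
  ln (\det A) + ln (\det B) <= \tr (A *m B) - k%:R /\
  (ln (\det A) + ln (\det B) = \tr (A *m B) - k%:R -> B = invmx A).
Proof.
move=> Apd Bpd; have [L Lu AE] := pdmx_factor Apd.
have LTu : L^T \in unitmx by rewrite unitmx_tr.
have := pdmx_congr (U := L^T) LTu Bpd; rewrite trmxK => Xpd.
have detX : \det (L *m B *m L^T) = \det A * \det B.
  by rewrite AE !det_mulmx det_tr; ring.
have trX : \tr (L *m B *m L^T) = \tr (A *m B).
  by rewrite mxtrace_mulC mulmxA AE.
have [_ X_le X_eq] := logdet_le_trace Xpd; move: X_le X_eq.
rewrite detX trX lnM ?posrE ?pdmx_det_gt0 // => X_le X_eq; split=> // /X_eq XE.
have Au := pdmx_unit Apd.
apply: (can_inj (mulKmx Au)); rewrite mulmxV // AE -mulmxA.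
apply: (can_inj (mulmxK LTu)); apply: (can_inj (mulKmx LTu)).
by rewrite [in RHS]mulmxA; rewrite -!mulmxA in XE *; rewrite XE mulmx1 mul1mx.
Qed.

(** With [w = A *m v], the form at [v + s *: w] is a quadratic in [s] without constant term and with
    linear coefficient [2 * |w|^2]. Being nonnegative for every [s], it has zero linear part. *)
Lemma psdmx_kernel {k} {A : 'M[R]_k} {v} : psdmx A -> qform A v = 0 -> A *m v = 0.
Proof.
move=> [As Ap] Av0; pose w := A *m v; pose b := \sum_i w i 0 ^+ 2.
have wE : (w^T *m w) 0 0 = b by rewrite mxE; apply: eq_bigr => i _; rewrite mxE expr2.
have H s : 0 <= s ^+ 2 * qform A w + 2 * s * b.
  suff <- : qform A (v + s *: w) = s ^+ 2 * qform A w + 2 * s * b by apply: Ap.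
  rewrite /qform in Av0 *.
  have -> : (v + s *: w)^T = v^T + s *: w^T by rewrite linearD linearZ.
  have vw : (v^T *m A *m w) 0 0 = b by rewrite -wE trmx_mul As.
  have wv : (w^T *m A *m v) 0 0 = b by rewrite -wE mulmxA.
  rewrite !mulmxDl !mulmxDr -!scalemxAr -!scalemxAl.
  have addE (X Y : 'M[R]_1) : (X + Y) 0 0 = X 0 0 + Y 0 0 by rewrite mxE.
  have scaleE c (X : 'M[R]_1) : (c *: X) 0 0 = c * X 0 0 by rewrite mxE.
  by rewrite !(addE, scaleE) Av0 vw wv; ring.
have b_ge0 : 0 <= b by apply: sumr_ge0 => i _; apply: sqr_ge0.
have b0 : b = 0.
  apply/eqP; rewrite eq_le b_ge0 andbT leNgt; apply/negP => b_gt0.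
  have q_ge0 := Ap w; set q := qform A w in H q_ge0.
  have q1 : q + 1 != 0 by rewrite gt_eqF // ltr_wpDl.
  (* The denominator [q + 1] is positive even when [q = 0], and this choice of [s] makes the
     quadratic negative. *)
  have := H (- (b / (q + 1))).
  have -> : (- (b / (q + 1))) ^+ 2 * q + 2 * (- (b / (q + 1))) * b
            = - ((b / (q + 1)) ^+ 2 * (q + 2)) by field.
  rewrite oppr_ge0 leNgt => /negP; apply; apply: mulr_gt0; last by rewrite ltr_wpDl.
  by rewrite exprn_gt0 // divr_gt0 // ltr_wpDl.
apply/colP => i; rewrite [RHS]mxE; apply/eqP; rewrite -sqrf_eq0.
move/eqP: b0; rewrite psumr_eq0 => [|j _]; last exact: sqr_ge0.
by move=> /allP/(_ i (mem_index_enum _)).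
Qed.

Lemma psdmx_pd {k} {A : 'M[R]_k} : psdmx A -> \det A != 0 -> pdmx A.
Proof.
move=> Apsd dA; have [As Ap] := Apsd; split=> // v v0.
rewrite lt_neqAle Ap andbT eq_sym; apply: contra_neq v0.
move=> /(psdmx_kernel Apsd) Av; apply: (can_inj (mulKmx (_ : A \in unitmx))).
  by rewrite unitmxE unitfE.
by rewrite Av mulmx0.
Qed.

Lemma psdmx_det_ge0 {k} {A : 'M[R]_k} : psdmx A -> 0 <= \det A.
Proof.
move=> Apsd; have [->//|dA] := eqVneq (\det A) 0.
exact/ltW/pdmx_det_gt0/psdmx_pd.
Qed.

End PositiveDefinite.

(** * Perturbation of positive definite matrices and determinants along a line *)

Section Perturbation.
Context {R : realType}.

(** From [|v_i v_j| <= (v_i^2 + v_j^2) / 2] one gets [qform E v >= - d * k * |v|^2], which the term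
    [|v|^2] of the identity outweighs. *)
Lemma pdmx_add1 {k} (E : 'M[R]_k) (d : R) :
  E^T = E -> (forall i j, `|E i j| <= d) -> d * k%:R < 1 -> pdmx (1%:M + E).
Proof.
move=> Es Ed dk; split=> [|v v0]; first by rewrite linearD /= trmx1 Es.
have [_ /(_ v v0)] := pdmx1 (R := R) (k := k).
have -> : qform 1%:M v = \sum_i v i 0 ^+ 2.
  by rewrite /qform mulmx1 mxE; apply: eq_bigr => i _; rewrite mxE expr2.
set q := \sum_i _ => q_gt0.
have : - (d * k%:R * q) <= qform E v.
  have -> : - (d * k%:R * q)
      = \sum_i \sum_j - (d * (2^-1 * (v i 0 ^+ 2 + v j 0 ^+ 2))).
    under eq_bigr do rewrite sumrN -!mulr_sumr big_split /= sumr_const card_ord.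
    rewrite sumrN -!mulr_sumr big_split /= sumr_const card_ord sumrMnl.
    by rewrite -/q -mulr_natr; field.
  rewrite qformE; apply: ler_sum => i _; apply: ler_sum => j _.
  apply: le_trans (lerNnormlW (lexx _)); rewrite lerN2 normrM ler_pM //.
  have := sqr_ge0 (`|v i 0| - `|v j 0|).
  by rewrite normrM sqrrB !real_normK ?num_real // mulr2n; lra.
rewrite qformD {2}/qform mulmx1.
have -> : (v^T *m v) 0 0 = q.
  by rewrite mxE; apply: eq_bigr => i _; rewrite mxE expr2.
have : d * k%:R * q < q by rewrite gtr_pMl.
lra.
Qed.

(** Congruence by the inverse [B] of a factor [L] of [A] reduces to the perturbation [B^T *m E *m B]
    of the identity. *)
Lemma pdmx_perturb {k} {A : 'M[R]_k} : pdmx A ->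
  exists2 e : R, 0 < e & forall E : 'M[R]_k,
    E^T = E -> (forall i j, `|E i j| <= e) -> pdmx (A + E).
Proof.
move=> /pdmx_factor[L Lu ->]; pose B := invmx L.
pose s := \sum_i \sum_j `|B i j|.
have s_ge0 : 0 <= s by apply: sumr_ge0 => i _; apply: sumr_ge0 => j _.
have e_gt0 : 0 < 1 + s ^+ 2 * k%:R by rewrite ltr_wpDr // mulr_ge0 ?sqr_ge0.
(* The entries of [B^T *m E *m B] are at most [e * s ^+ 2], and this value of [e] gives
   [e * s ^+ 2 * k < 1], as [pdmx_add1] requires. *)
exists (1 + s ^+ 2 * k%:R)^-1; first by rewrite invr_gt0.
set e := _^-1 => E Es Ee.
have -> : L^T *m L + E = L^T *m (1%:M + B^T *m E *m B) *m L.
  rewrite mulmxDr mulmxDl mulmx1 !mulmxA -trmx_mul mulVmx // trmx1 mul1mx.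
  by rewrite -mulmxA mulVmx // mulmx1.
apply: (pdmx_congr Lu); apply: (@pdmx_add1 _ _ (e * s ^+ 2)).
- by rewrite !trmx_mul trmxK Es mulmxA.
- have colB j : \sum_i `|B i j| <= s.
    rewrite /s exchange_big [leRHS](bigD1 j) //= lerDl.
    by apply: sumr_ge0 => ? _; apply: sumr_ge0.
  move=> i j; rewrite mxE.
  apply: (le_trans (ler_norm_sum _ _ _)).
  apply: (@le_trans _ _ (\sum_b e * s * `|B b j|)); last first.
    rewrite -mulr_sumr expr2 mulrA ler_wpM2l // mulr_ge0 // invr_ge0 ltW //.
  apply: ler_sum => b _; rewrite normrM ler_wpM2r // mxE.
  apply: (le_trans (ler_norm_sum _ _ _)).
  apply: (@le_trans _ _ (\sum_a e * `|B a i|)); last first.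
    by rewrite -mulr_sumr ler_wpM2l // invr_ge0 ltW.
  apply: ler_sum => a _; rewrite normrM mxE mulrC ler_wpM2r //.
- by rewrite -mulrA mulrC -ltr_pdivlMr ?invr_gt0 // invrK mul1r ltrDr ltr01.
Qed.

(** Turns the first-order variation of the determinant into the coefficient of degree one of a
    polynomial, so that stationarity can be expressed without derivatives. *)
Lemma det_line_poly {k} (C : 'M[R]_k) :
  exists p : {poly R}, [/\ forall s, p.[s] = \det (1%:M + s *: C),
    p`_0 = 1 & p`_1 = \tr C].
Proof.
case: k C => [|k] C.
  exists 1; split=> [s||]; first by rewrite det_mx00 hornerC.
    by rewrite coef1.
  by rewrite coef1 /mxtrace big_ord0.
pose q := char_poly (- C).
have qE x : q.[x] = \det (x%:M + C).
  rewrite /q /char_poly -horner_evalE -det_map_mx; congr (\det _).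
  apply/matrixP => i j; rewrite !mxE /= horner_evalE !hornerE hornerMn hornerX.
  by rewrite opprK.
have szq : size q = k.+2 by rewrite size_char_poly.
have qm : q`_k.+1 = 1.
  by have /monicP := char_poly_monic (- C); rewrite lead_coefE szq.
(* det (1 + s C) = s^(k+1) q(1/s): reverse the coefficients of q. *)
exists (\poly_(i < k.+2) q`_(k.+1 - i)); split=> [s||].
- rewrite horner_poly; have [->|s0] := eqVneq s 0.
    rewrite scale0r addr0 det1 big_ord_recl expr0 mulr1 subn0 qm big1 ?addr0 //.
    by move=> i _; rewrite expr0n mulr0.
  have -> : 1%:M + s *: C = s *: (s^-1%:M + C).
    by rewrite scalerDr scale_scalar_mx mulfV.
  rewrite detZ -qE horner_coef szq mulr_sumr (reindex_inj rev_ord_inj) /=.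
  apply: eq_bigr => i _; rewrite subSS mulrCA; congr (_ * _).
    by congr (q`_ _); have := ltn_ord i; lia.
  by rewrite exprVn -expfB_cond ?(negPf s0) //; have := ltn_ord i; lia.
- by rewrite coef_poly subn0.
- by rewrite coef_poly subn1 /= char_poly_trace // linearN opprK.
Qed.

End Perturbation.

(** * Polynomial identities and sums of squares *)

Section RealPolynomials.
Context {R : realType} {n : nat}.
Implicit Types (p q : {mpoly R[n]}) (x : 'rV[R]_n).

Lemma seq_argmax {T : eqType} {d} {U : orderType d} (f : T -> U) (s : seq T) :
  s != [::] -> exists2 a, a \in s & {in s, forall b, (f b <= f a)%O}.
Proof.
elim: s => // a [|b s] IH _.
  by exists a; rewrite ?inE // => c; rewrite inE => /eqP->.
have [c cs cmax] := IH isT; have [fac|fca] := leP (f a) (f c).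
  exists c; first by rewrite inE cs orbT.
  by move=> e; rewrite inE => /predU1P[->//|/cmax].
exists a; first by rewrite inE eqxx.
move=> e; rewrite inE => /predU1P[->//|/cmax fe].
exact: le_trans fe (ltW fca).
Qed.

(** The lowest digit is the residue modulo [D]; cancelling it and dividing by [D] leaves the
    induction hypothesis. *)
Lemma digits_inj {k} (D : nat) (a b : 'I_k -> nat) :
  (forall i, a i < D)%N -> (forall i, b i < D)%N ->
  (\sum_(i < k) a i * D ^ i = \sum_(i < k) b i * D ^ i)%N -> a =1 b.
Proof.
elim: k a b => [|k IH] a b aD bD; first by move=> _ [].
have D0 : (0 < D)%N by apply: leq_ltn_trans (aD ord0).
rewrite !big_ord_recl !expn0 !muln1.
have shift (c : 'I_k.+1 -> nat) : (\sum_(i < k) c (lift ord0 i) * D ^ lift ord0 i =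
    (\sum_(i < k) c (lift ord0 i) * D ^ i) * D)%N.
  by rewrite big_distrl /=; apply: eq_bigr => i _; rewrite expnSr mulnA.
rewrite !shift ![(_ ord0 + _)%N]addnC => H i.
have H0 : a ord0 = b ord0.
  by have := congr1 (modn^~ D) H; rewrite /= !modnMDl !modn_small.
have Hl : (fun j => a (lift ord0 j)) =1 (fun j => b (lift ord0 j)).
  apply: IH => //; move: H; rewrite H0 => /addIn/eqP.
  by rewrite eqn_pmul2r // => /eqP.
by case: (unliftP ord0 i) => [j ->|->//]; apply: Hl.
Qed.

Lemma size_prod_succ {I : finType} (F : I -> {poly R}) (w : I -> nat) :
  (forall i, size (F i) = (w i).+1) -> size (\prod_i F i) = (\sum_i w i).+1.
Proof.
move=> Fw; elim/big_ind2: _ => [|p k q l pk ql|//]; first by rewrite size_poly1.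
rewrite size_mul ?pk ?ql -?size_poly_gt0 ?pk ?ql //; lia.
Qed.

Lemma size_exp_succ (q : {poly R}) w k :
  size q = w.+1 -> size (q ^+ k) = (k * w).+1.
Proof.
move=> qw; have q0 : q != 0 by rewrite -size_poly_gt0 qw.
have := size_exp q k; rewrite qw /= mulnC => <-.
by rewrite prednK // size_poly_gt0 expf_neq0.
Qed.

(* Along the curve s |-> x + (e / 2) (s ^ (D ^ i))_i with D > d, distinct
   monomials of degree at most d become univariate polynomials of distinct
   degrees. *)
Lemma unisolvent_points x (e : R) (d : nat) : 0 < e ->
  exists (k : nat) (y : 'I_k -> 'rV[R]_n),
    (forall j i, `|x 0 i - y j 0 i| < e) /\
    forall p, (msize p <= d.+1)%N -> (forall j, peval p (y j) = 0) -> p = 0.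
Proof.
move=> e0; pose D := d.+1.
pose c (i : 'I_n) : {poly R} := (x 0 i)%:P + (e / 2) *: 'X^(D ^ i).
pose w (m : multinom n) := (\sum_(i < n) m i * D ^ i)%N.
have e2 : e / 2 != 0 by rewrite gt_eqF // divr_gt0.
have sizec i : size (c i) = (D ^ i).+1.
  rewrite /c addrC size_polyDl size_scale // size_polyXn //.
  by rewrite (leq_ltn_trans (size_polyC_leq1 _)) // ltnS expn_gt0.
have size1 m : size (mmap1 c m) = (w m).+1.
  by apply: size_prod_succ => i; apply: size_exp_succ.
pose P p := mmap polyC c p.
have PE p : P p = \sum_(m <- msupp p) p@_m *: mmap1 c m.
  by apply: eq_bigr => m _; rewrite mul_polyC.
have w_inj m1 m2 : (mdeg m1 <= d)%N -> (mdeg m2 <= d)%N -> w m1 = w m2 -> m1 = m2.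
  have le_mdeg (m : multinom n) i : (m i <= mdeg m)%N.
    by rewrite mdegE (bigD1 i) //= leq_addr.
  move=> d1 d2 /digits_inj H; apply/mnmP/H => i;
    by rewrite ltnS (leq_trans (le_mdeg _ _)).
(* The degree of [P p] is at most [d * D ^ n], so vanishing at [k] distinct parameters forces
   [P p = 0]. Parameters in [[0, 1]] keep the points within [e / 2] of [x]. *)
pose k := (d * D ^ n).+2.
pose s (j : 'I_k) : R := j%:R / k%:R.
have s01 j : 0 <= s j <= 1.
  rewrite divr_ge0 //= ler_pdivrMr ?ltr0n // mul1r ler_nat ltnW //.
pose y j : 'rV[R]_n := \row_i (c i).[s j].
exists k, y; split=> [j i|p pd py].
  have /andP[s0 s1] := s01 j.
  rewrite mxE !hornerE opprD addNKr normrN normrM gtr0_norm ?divr_gt0 //.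
  rewrite ger0_norm ?exprn_ge0 //.
  have := exprn_ile1 (D ^ i) s0 s1.
  have : 0 < e / 2 by rewrite divr_gt0.
  nra.
have horP t : (P p).[t] = peval p (\row_i (c i).[t]).
  rewrite PE /peval mevalE -horner_evalE raddf_sum; apply: eq_bigr => m _.
  rewrite /= horner_evalE hornerZ; congr (_ * _).
  rewrite /mmap1 -horner_evalE rmorph_prod; apply: eq_bigr => i _.
  by rewrite rmorphXn /= horner_evalE mxE.
have mdegp m : m \in msupp p -> (mdeg m <= d)%N.
  by move=> /msize_mdeg_lt mp; rewrite -ltnS (leq_trans mp).
have sizeP : (size (P p) < k)%N.
  rewrite ltnS PE; apply: leq_trans (size_sum _ _ _) _.
  apply/bigmax_leqP_seq => m mp _; apply: leq_trans (size_scale_leq _ _) _.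
  rewrite size1 ltnS; apply: (@leq_trans (mdeg m * D ^ n)); last first.
    by rewrite leq_mul2r mdegp ?orbT.
  rewrite mdegE big_distrl /=; apply: leq_sum => i _.
  by rewrite leq_mul2l leq_pexp2l ?orbT // ltnW.
have P0 : P p = 0.
  apply/eqP; apply: contraTT sizeP => P0; rewrite -leqNgt.
  have /(max_poly_roots P0) : all (root (P p)) (map s (enum 'I_k)).
    by apply/allP => _ /mapP[j _ ->]; rewrite /root horP py.
  rewrite size_map size_enum_ord; move=> H; apply/ltnW/H.
  rewrite map_inj_uniq ?enum_uniq // => i j /(congr1 ( *%R^~ k%:R)).
  rewrite /s !divfK ?pnatr_eq0 // => /eqP; rewrite eqr_nat => /eqP.
  exact: val_inj.
apply/eqP; case: (eqVneq p 0) => // p0.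
(* A monomial [m] of [p] of maximal weight is alone in contributing to the coefficient of degree
   [w m]: by [w_inj] all others have smaller weight. That coefficient of [P p] is therefore
   nonzero. *)
have := @seq_argmax _ _ nat w (msupp p).
case=> [|m mp mmax]; first by rewrite msupp_eq0.
have := congr1 (fun r : {poly R} => r`_(w m)) P0.
rewrite PE coef_sum coef0 (bigD1_seq m) ?msupp_uniq //= coefZ big1_seq.
  move/eqP; rewrite addr0 mulf_eq0 => /orP[].
    by rewrite mcoeff_eq0 mp.
  have -> : (mmap1 c m)`_(w m) = lead_coef (mmap1 c m) by rewrite lead_coefE size1.
  by rewrite lead_coef_eq0 -size_poly_leq0 size1.
move=> m' /andP[mm' m'p]; rewrite coefZ nth_default ?mulr0 // size1.
rewrite ltn_neqAle; have := mmax _ m'p; rewrite leEnat => ->; rewrite andbT.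
by apply: contra_neq mm' => /w_inj; apply; apply: mdegp.
Qed.

Lemma peval_inj p q : (forall x, peval p x = peval q x) -> p = q.
Proof.
move=> pq; have [k [y [_ H]]] := @unisolvent_points 0 1 (msize (p - q)) ltr01.
apply/eqP; rewrite -subr_eq0; apply/eqP/H => // j.
by rewrite /peval mevalB -!/(peval _ _) pq subrr.
Qed.

End RealPolynomials.

(** * Leading terms of squares, monomial bases and Gram matrices *)

Section GramPolynomials.
Context {R : realType} {n : nat}.
Implicit Types (p q g : {mpoly R[n]}) (x : 'rV[R]_n).

Lemma mcoeff_sqr_ge_mlead q m : (mlead q <= m)%O ->
  (q ^+ 2)@_(mnm_add m m) = q@_m ^+ 2.
Proof.
rewrite le_eqVlt => /predU1P[<-|qm]; first by rewrite expr2 mleadcM -expr2.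
rewrite (mcoeff_gt_mlead qm) expr0n mcoeff_gt_mlead // expr2.
by apply: le_lt_trans (mleadM_le _ _) _; apply: ltm_add.
Qed.

(* The leading terms of the squares add up to a positive coefficient, so they
   cannot cancel. *)
Lemma msize_sum_sqr (qs : seq {mpoly R[n]}) q : q \in qs -> q != 0 ->
  (2 * mdegree q < msize (\sum_(r <- qs) r ^+ 2))%N.
Proof.
move=> qqs q0; have q'qs : q \in [seq r <- qs | r != 0] by rewrite mem_filter /= q0.
have [|a] := @seq_argmax _ _ _ (@mlead n R) [seq r <- qs | r != 0].
  by apply: contraTneq q'qs => ->.
rewrite mem_filter /= => /andP[a0 aqs] amax; set m := mlead a.
have rmax r : r \in qs -> r != 0 -> (mlead r <= m)%O.
  by move=> rqs r0; apply: amax; rewrite mem_filter /= r0.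
have : mnm_add m m \in msupp (\sum_(r <- qs) r ^+ 2).
  rewrite mcoeff_msupp raddf_sum /= gt_eqF //.
  have cE r : r \in qs -> (r ^+ 2)@_(mnm_add m m) = r@_m ^+ 2.
    move=> rqs; have [->|r0] := eqVneq r 0; last exact/mcoeff_sqr_ge_mlead/rmax.
    by rewrite expr0n !mcoeff0 expr0n.
  rewrite big_seq lt_neqAle sumr_ge0 ?andbT => [|r /cE->]; last exact: sqr_ge0.
  rewrite eq_sym psumr_neq0 => [|r /cE->]; last exact: sqr_ge0.
  apply/hasP; exists a => //; rewrite aqs cE // exprn_even_gt0 //=.
  by rewrite mleadc_eq0.
move=> /msize_mdeg_lt; apply: leq_ltn_trans; rewrite mdegD addnn -mul2n leq_mul2l.
by rewrite /mdegree -mlead_deg //= lemc_mdeg ?orbT // rmax.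
Qed.

Lemma mnm_sub_of_mdeg (m : multinom n) k : (k <= mdeg m)%N ->
  exists2 a, mpoly.lem a m & mdeg a = k.
Proof.
elim: k => [|k IH] km.
  by exists (@mnm0 n); [apply/mnm_lepP => i; rewrite mnm0E | apply: mdeg0].
have [a am ak] := IH (ltnW km).
have /mnm_lepP am' := am.
have /existsP[i ai] : [exists i, a i < m i]%N.
  apply: contraLR km => /existsPn ma; rewrite -leqNgt -ak !mdegE.
  by apply: leq_sum => i _; rewrite leqNgt.
exists (mnm_add a (mnm1 i)); last by rewrite mdegD mdeg1 ak addn1.
apply/mnm_lepP => j; rewrite mnmDE mnm1E.
by case: eqVneq => [<-|_]; rewrite ?addn1 ?addn0.
Qed.

(** A divisor of [m] of degree [min d (mdeg m)] leaves a cofactor of degree at most [d]. Hence every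
    moment of order at most [2 * t] is an entry of the moment matrix. *)
Lemma mnm_split (m : multinom n) d : (mdeg m <= 2 * d)%N ->
  exists a b, [/\ m = mnm_add a b, (mdeg a <= d)%N & (mdeg b <= d)%N].
Proof.
move=> md; have [a am ad] := mnm_sub_of_mdeg _ _ (geq_minr d (mdeg m)).
exists a, (mnm_sub m a); have mE := submK am; split; first by rewrite addmC mE.
  by rewrite ad geq_minl.
by have := congr1 mdeg mE; rewrite mdegD ad; lia.
Qed.

Lemma expo_inj {d} : injective (@expo n d).
Proof. by move=> i j /val_inj/enum_val_inj. Qed.

Lemma mdeg_expo {d} (i : 'I_(nmonom n d)) : (mdeg (expo i) <= d)%N.
Proof. by rewrite -ltnS bmdeg. Qed.

Lemma expo_surj {d} (m : multinom n) : (mdeg m <= d)%N ->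
  exists i : 'I_(nmonom n d), expo i = m.
Proof.
rewrite -ltnS => md; exists (enum_rank (BMultinom md)).
by rewrite /expo enum_rankK.
Qed.

Lemma mcoeff_poly_of_coefs {d} (c : 'rV[R]_(nmonom n d)) i :
  (poly_of_coefs c)@_(expo i) = c 0 i.
Proof.
rewrite /poly_of_coefs raddf_sum (bigD1 i) //= mcoeffZ mcoeffX eqxx mulr1.
rewrite big1 ?addr0 // => j ji; rewrite mcoeffZ mcoeffX.
by rewrite (inj_eq expo_inj) (negPf ji) mulr0.
Qed.

Lemma msize_poly_of_coefs {d} (c : 'rV[R]_(nmonom n d)) :
  (msize (poly_of_coefs c) <= d.+1)%N.
Proof.
apply: leq_trans (msize_sum _ _ _) _; apply/bigmax_leqP_seq => i _ _.
by apply: leq_trans (msizeZ_le _ _) _; rewrite msizeX ltnS mdeg_expo.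
Qed.

Lemma poly_of_coefsK d p : (msize p <= d.+1)%N ->
  poly_of_coefs (\row_(i < nmonom n d) p@_(expo i)) = p.
Proof.
move=> /mpolywE {2}->; rewrite /poly_of_coefs.
rewrite (reindex (fun i : 'I_(nmonom n d) => enum_val i)); last first.
  by apply: onW_bij; apply: enum_val_bij.
by apply: eq_bigr => i _; rewrite mxE.
Qed.

(** The polynomial [v^T Q v] in the vector [v] of monomials of degree at most [d]. *)
Definition gram {d} (Q : 'M[R]_(nmonom n d)) : {mpoly R[n]} :=
  \sum_i \sum_j Q i j *: mpolyX R (mnm_add (expo i) (expo j)).

Lemma gramD {d} (P Q : 'M[R]_(nmonom n d)) : gram (P + Q) = gram P + gram Q.
Proof.
rewrite /gram -big_split; apply: eq_bigr => i _.
by rewrite -big_split; apply: eq_bigr => j _; rewrite mxE scalerDl.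
Qed.

Lemma gramZ {d} a (Q : 'M[R]_(nmonom n d)) : gram (a *: Q) = a *: gram Q.
Proof.
rewrite /gram scaler_sumr; apply: eq_bigr => i _.
by rewrite scaler_sumr; apply: eq_bigr => j _; rewrite mxE scalerA.
Qed.

Lemma gram0 {d} : gram (0 : 'M[R]_(nmonom n d)) = 0.
Proof. by rewrite -(scale0r 0) gramZ scale0r. Qed.

Lemma peval_gram {d} (Q : 'M[R]_(nmonom n d)) x :
  peval (gram Q) x = qform Q (vmonom d x).
Proof.
rewrite qformE /peval raddf_sum; apply: eq_bigr => i _.
rewrite raddf_sum; apply: eq_bigr => j _.
by rewrite /= mevalZ mpolyXD mevalM !mxE.
Qed.

Lemma gram_outer {d} (v : 'cV[R]_(nmonom n d)) :
  gram (v *m v^T) = poly_of_coefs v^T ^+ 2.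
Proof.
rewrite expr2 /poly_of_coefs mulr_suml; apply: eq_bigr => i _.
rewrite mulr_sumr; apply: eq_bigr => j _.
by rewrite -scalerAl -scalerAr scalerA -mpolyXD !mxE big_ord1 !mxE.
Qed.

Lemma gram_factor {d k} (L : 'M[R]_(k, nmonom n d)) :
  gram (L^T *m L) = \sum_i poly_of_coefs (row i L) ^+ 2.
Proof.
have -> : L^T *m L = \sum_i (row i L)^T *m (row i L)^T^T.
  apply/matrixP => a b; rewrite mxE summxE; apply: eq_bigr => i _.
  by rewrite !mxE big_ord1 !mxE.
rewrite (big_morph _ gramD gram0); apply: eq_bigr => i _.
by rewrite gram_outer trmxK.
Qed.

Lemma sos_gram {d} (Q : 'M[R]_(nmonom n d)) : pdmx Q -> sos (gram Q).
Proof.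
move=> /pdmx_factor[L _ ->].
exists [seq poly_of_coefs (row i L) | i <- enum 'I_(nmonom n d)].
by rewrite gram_factor big_map big_enum.
Qed.

Lemma msize_gram {d} (Q : 'M[R]_(nmonom n d)) : (msize (gram Q) <= (2 * d).+1)%N.
Proof.
apply: leq_trans (msize_sum _ _ _) _; apply/bigmax_leqP_seq => i _ _.
apply: leq_trans (msize_sum _ _ _) _; apply/bigmax_leqP_seq => j _ _.
apply: leq_trans (msizeZ_le _ _) _; rewrite msizeX ltnS mdegD mul2n -addnn.
by rewrite leq_add ?mdeg_expo.
Qed.

(* Spreads each coefficient evenly over the pairs (i, j) with
   expo i + expo j equal to its exponent. *)
Definition hankel d p : 'M[R]_(nmonom n d) :=
  \matrix_(i, j) (p@_(mnm_add (expo i) (expo j)) /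
    #|[pred u : 'I_(nmonom n d) * 'I_(nmonom n d) |
        mnm_add (expo u.1) (expo u.2) == mnm_add (expo i) (expo j)]|%:R).

Lemma hankel_sym d p : (hankel d p)^T = hankel d p.
Proof. by apply/matrixP => i j; rewrite !mxE [mnm_add (expo j) _]addmC. Qed.

Lemma hankel_le d p i j :
  `|hankel d p i j| <= `|p@_(mnm_add (expo i) (expo j))|.
Proof.
rewrite mxE normrM ler_piMr //.
rewrite normfV ger0_norm // invf_le1 ?ler1n ?ltr0n //;
  by apply/card_gt0P; exists (i, j); rewrite inE.
Qed.

Lemma gram_hankel d p : (msize p <= (2 * d).+1)%N -> gram (hankel d p) = p.
Proof.
move=> pd; apply/mpolyP => m; rewrite /gram.
rewrite pair_big /= raddf_sum /=.
rewrite (bigID (fun u => mnm_add (expo u.1) (expo u.2) == m)) /=.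
rewrite [X in _ + X]big1 ?addr0 => [|u um]; last first.
  by rewrite mcoeffZ mcoeffX (negPf um) mulr0.
pose c := #|[pred u : 'I_(nmonom n d) * 'I_(nmonom n d) |
              mnm_add (expo u.1) (expo u.2) == m]|.
rewrite (eq_bigr (fun=> p@_m / c%:R)) => [|u /eqP um]; last first.
  by rewrite mcoeffZ mcoeffX mxE um eqxx mulr1.
rewrite sumr_const; have [/eqP c0|c0] := posnP c; last first.
  by rewrite -[LHS]mulr_natr divfK // pnatr_eq0 -lt0n.
(* If no pair of row exponents adds up to [m], then by [mnm_split] the degree of [m] exceeds
   [2 * d], and [p] has no such term. *)
rewrite memN_msupp_eq0 ?mul0r ?mul0rn //.
apply: contraL c0 => /msize_mdeg_lt/leq_trans/(_ pd).
rewrite ltnS => /mnm_split[a [b [mE /expo_surj[i ia] /expo_surj[j jb]]]].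
by rewrite -lt0n; apply/card_gt0P; exists (i, j); rewrite inE /= ia jb mE.
Qed.

End GramPolynomials.

(** * Moments and weak duality *)

Section Moments.
Context {R : realType} {n : nat}.
Implicit Types (p q g : {mpoly R[n]}).

Lemma riesz_is_linear {d} (phi : 'rV[R]_(nmonom n d)) : scalar (riesz phi).
Proof.
move=> a p q; rewrite /riesz mulr_sumr -big_split; apply: eq_bigr => i _ /=.
by rewrite mcoeffD mcoeffZ mulrDl mulrA.
Qed.

HB.instance Definition _ {d} (phi : 'rV[R]_(nmonom n d)) :=
  GRing.isLinear.Build R {mpoly R[n]} R *%R (riesz phi) (riesz_is_linear phi).

Lemma rieszDl {d} (phi psi : 'rV[R]_(nmonom n d)) p :
  riesz (phi + psi) p = riesz phi p + riesz psi p.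
Proof.
by rewrite /riesz -big_split; apply: eq_bigr => i _; rewrite mxE mulrDr.
Qed.

Lemma rieszZl {d} a (phi : 'rV[R]_(nmonom n d)) p :
  riesz (a *: phi) p = a * riesz phi p.
Proof.
by rewrite /riesz mulr_sumr; apply: eq_bigr => i _; rewrite mxE mulrCA.
Qed.

Lemma riesz_poly_of_coefs {d} (phi c : 'rV[R]_(nmonom n d)) :
  riesz phi (poly_of_coefs c) = \sum_i c 0 i * phi 0 i.
Proof. by apply: eq_bigr => i _; rewrite mcoeff_poly_of_coefs. Qed.

Lemma riesz_delta d p (i : 'I_(nmonom n d)) : riesz (delta_mx 0 i) p = p@_(expo i).
Proof.
rewrite /riesz (bigD1 i) //= big1 => [|j ji]; first by rewrite mxE !eqxx mulr1 addr0.
by rewrite mxE (negPf ji) andbF mulr0.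
Qed.

Lemma riesz_expo {d} (phi : 'rV[R]_(nmonom n d)) i :
  riesz phi (mpolyX R (expo i)) = phi 0 i.
Proof.
rewrite /riesz (bigD1 i) //= big1 => [|j ji].
  by rewrite mcoeffX eqxx mul1r addr0.
by rewrite mcoeffX (inj_eq expo_inj) eq_sym (negPf ji) mul0r.
Qed.

Context {t : nat}.
Implicit Types phi psi : 'rV[R]_(nmonom n (2 * t)).

Lemma locmx_sym phi g : (locmx phi g)^T = locmx phi g.
Proof. by apply/matrixP => i j; rewrite !mxE [mnm_add (expo j) _]addmC. Qed.

Lemma locmxD phi psi g : locmx (phi + psi) g = locmx phi g + locmx psi g.
Proof. by apply/matrixP => i j; rewrite !mxE rieszDl. Qed.

Lemma locmxZ a phi g : locmx (a *: phi) g = a *: locmx phi g.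
Proof. by apply/matrixP => i j; rewrite !mxE rieszZl. Qed.

(** The maps sending [phi] to [locmx phi g] and [Q] to [g * gram Q] are adjoint; the primal and dual
    constraints are linked through this identity. *)
Lemma trace_locmx phi g (Q : 'M[R]_(msz t g)) :
  \tr (locmx phi g *m Q) = riesz phi (g * gram Q).
Proof.
rewrite -mxtrace_tr trmx_mul locmx_sym /mxtrace mulr_sumr linear_sum.
under eq_bigr do rewrite mxE; rewrite exchange_big; apply: eq_bigr => i _.
rewrite mulr_sumr linear_sum; apply: eq_bigr => j _.
by rewrite !mxE -scalerAr linearZ.
Qed.

Lemma qform_locmx phi g (v : 'cV[R]_(msz t g)) :
  qform (locmx phi g) v = riesz phi (g * poly_of_coefs v^T ^+ 2).
Proof.
rewrite -gram_outer -trace_locmx /qform -trace_mx11 mxtrace_mulC mulmxA.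
by rewrite mxtrace_mulC.
Qed.

Lemma riesz_sqr_ge0 phi g q : psdmx (locmx phi g) ->
  ((msize q).-1 <= t - halfdeg g)%N -> 0 <= riesz phi (g * q ^+ 2).
Proof.
move=> [_ Mge0]; rewrite -ltnS => /(leq_trans (leqSpred _))/poly_of_coefsK<-; set c := \row__ _.
by rewrite -[c]trmxK -qform_locmx.
Qed.

(** Every exponent of degree at most [2 * t] is a sum of two of degree at most [t], so all moments
    appear in the matrix for [g = 1]. *)
Lemma locmx1_inj phi psi : locmx phi 1 = locmx psi 1 -> phi = psi.
Proof.
move=> M1; apply/rowP => k; have := mdeg_expo k.
move=> /mnm_split[a [b [kE al bl]]].
have t1 : (t - halfdeg (1%R : {mpoly R[n]}))%N = t.
  by rewrite /halfdeg /mdegree msize1 subn0.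
rewrite -t1 in al bl.
have [i ia] := expo_surj _ al; have [j jb] := expo_surj _ bl.
have := congr1 (fun M : 'M[R]_(msz t 1) => M i j) M1.
by rewrite !mxE !mul1r ia jb -kE !riesz_expo.
Qed.

(** By [msize_sum_sqr] the squares in a multiplier cannot cancel in top degree, so the degree bound
    on the product passes to each [q]. A nonzero [q] then fits in the localizing matrix of [h], and
    [h] lies in [truncG G t]. *)
Lemma riesz_qmodule_ge0 (G : {fset {mpoly R[n]}}) phi p : 0 \notin G ->
  (forall h : truncG G t, psdmx (locmx phi (val h))) ->
  qmodule G t p -> 0 <= riesz phi p.
Proof.
move=> G0 Mpsd [s [sP ->]]; rewrite linear_sum; apply: sumr_ge0 => h _ /=.
have [[qs sE] szs] := sP h; have [s0|s0] := eqVneq (s h) 0.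
  by rewrite s0 mul0r linear0.
have h0 : val h != 0 by apply: contraNneq G0 => <-; apply: valP.
move: szs; rewrite msizeM // => szs.
rewrite sE mulr_suml linear_sum big_seq; apply: sumr_ge0 => q qqs.
have [->|q0] := eqVneq q 0; first by rewrite expr0n mul0r linear0.
have := msize_sum_sqr _ _ qqs q0; rewrite -sE /mdegree => szq.
have sh : (0 < msize (val h))%N by rewrite lt0n msize_poly_eq0.
have sq : (0 < msize q)%N by rewrite lt0n msize_poly_eq0.
have tq : (halfdeg (val h) + (msize q).-1 <= t)%N.
  (* In degrees: [deg s + deg h <= 2 * t] and [2 * deg q <= deg s] give [deg q + deg h / 2 <= t],
     and integrality allows the half to be rounded up. *)
  have arith (a b c : nat) : (0 < a -> 0 < b -> (c + a).-1 <= (2 * t).+1 ->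
    2 * b.-1 < c -> uphalf a.-1 + b.-1 <= t)%N by rewrite uphalfE; lia.
  exact: arith sh sq szs szq.
have hG : val h \in truncG G t.
  rewrite !inE; apply/andP; split; first exact: valP.
  exact: leq_trans (leq_addr _ _) tq.
rewrite mulrC; apply: (riesz_sqr_ge0 _ _ _ (Mpsd [` hG]%fset)).
by rewrite leq_subRL // (leq_trans (leq_addr _ _) tq).
Qed.

End Moments.

(** * Weak duality, its equality case, and stationary points *)

Section Duality.
Context {R : realType} {n : nat} {G : {fset {mpoly R[n]}}} {t : nat}.
Implicit Types (phi : 'rV[R]_(nmonom n (2 * t))) (Q : gram_family G t).

Lemma logdet_pdmx {k} {A : 'M[R]_k} : pdmx A -> logdet A = (ln (\det A))%:E.
Proof. by move=> /pdmx_det_gt0/lt0r_neq0/negPf dA; rewrite /logdet dA. Qed.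

Lemma logdet_singular {k} {A : 'M[R]_k} : psdmx A -> ~ pdmx A -> logdet A = -oo%E.
Proof.
move=> Apsd nApd; rewrite /logdet; case: eqVneq => // dA.
by case: nApd; apply: psdmx_pd.
Qed.

Lemma sum_logdet_pdmx {I : finType} {k : I -> nat} {A : forall i, 'M[R]_(k i)} :
  (forall i, pdmx (A i)) ->
  (\sum_i logdet (A i))%E = (\sum_i ln (\det (A i)))%:E.
Proof.
by move=> Apd; rewrite -sumEFin; apply: eq_bigr => i _; apply: logdet_pdmx.
Qed.

Lemma sum_logdet_singular {I : finType} {k : I -> nat} {A : forall i, 'M[R]_(k i)} :
  (forall i, psdmx (A i)) -> ~ (forall i, pdmx (A i)) ->
  (\sum_i logdet (A i))%E = -oo%E.
Proof.
move=> Apsd /existsNP[i nAi]; rewrite (bigD1 i) //= (logdet_singular (Apsd i) nAi) //.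
Qed.

Lemma dual_gram {Q} : dual_feasible Q ->
  \sum_(h : truncG G t) val h * gram (Q h) = mpolyC n (total_size G t)%:R.
Proof.
move=> [_ QE]; apply: peval_inj => x.
rewrite /peval mevalC (QE x) raddf_sum; apply: eq_bigr => h _ /=.
by rewrite mevalM -!/(peval _ _) peval_gram.
Qed.

Lemma riesz_const {d} (phi : 'rV[R]_(nmonom n d)) c :
  riesz phi (mpolyC n c) = c * riesz phi 1.
Proof.
by rewrite -linearZ /= -mul_mpolyC mulr1.
Qed.

Lemma sum_trace_locmx {phi Q} : primal_feasible G phi -> dual_feasible Q ->
  \sum_(h : truncG G t) \tr (locmx phi (val h) *m Q h) = (total_size G t)%:R.
Proof.
move=> [phi1 _] /dual_gram QE.
have := riesz_const phi (total_size G t)%:R; rewrite phi1 mulr1 -QE => <-.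
by rewrite linear_sum; apply: eq_bigr => h _; rewrite trace_locmx.
Qed.

(** Sums [logdet_mul_le_trace] over the constraints. The traces add up to the total size, so the
    nonnegative gaps add up to [- s], and [s = 0] makes each of them vanish. *)
Lemma sum_logdet_le0 {phi Q} : primal_feasible G phi -> dual_feasible Q ->
  (forall h : truncG G t, pdmx (locmx phi (val h))) -> (forall h, pdmx (Q h)) ->
  let s := \sum_(h : truncG G t) ln (\det (locmx phi (val h)))
             + \sum_(h : truncG G t) ln (\det (Q h)) in
  s <= 0 /\ (s = 0 -> forall h : truncG G t, Q h = invmx (locmx phi (val h))).
Proof.
move=> phiP QP Mpd Qpd; have trE := sum_trace_locmx phiP QP.
pose gap (h : truncG G t) := \tr (locmx phi (val h) *m Q h) - (msz t (val h))%:R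
  - (ln (\det (locmx phi (val h))) + ln (\det (Q h))).
have gap_ge0 h : 0 <= gap h.
  by rewrite subr_ge0; case: (logdet_mul_le_trace (Mpd h) (Qpd h)).
have gapE : \sum_h gap h =
    - (\sum_(h : truncG G t) ln (\det (locmx phi (val h)))
       + \sum_(h : truncG G t) ln (\det (Q h))).
  by rewrite !sumrB big_split /= trE /total_size natr_sum; ring.
split=> [|s0 h]; first by rewrite -oppr_ge0 -gapE sumr_ge0.
have /eqP : \sum_h gap h = 0 by rewrite gapE s0 oppr0.
rewrite psumr_eq0 // => /allP/(_ h (mem_index_enum _)).
rewrite /gap subr_eq0 => /eqP gap0.
by case: (logdet_mul_le_trace (Mpd h) (Qpd h)) => _; apply.
Qed.

(** A singular matrix on either side makes an objective infinite and the inequality trivial;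
    otherwise [sum_logdet_le0] applies. *)
Lemma weak_duality {phi Q} : primal_feasible G phi -> dual_feasible Q ->
  (dual_obj Q <= primal_obj G phi)%E.
Proof.
move=> phiP QP; have [_ Mpsd] := phiP; have [Qpsd _] := QP.
rewrite /dual_obj /primal_obj.
have [Qpd|nQ] := pselect (forall h, pdmx (Q h)); last first.
  by rewrite (sum_logdet_singular Qpsd nQ) leNye.
have [Mpd|nM] := pselect (forall h : truncG G t, pdmx (locmx phi (val h))); last first.
  by rewrite (sum_logdet_singular Mpsd nM) leey.
have [] := sum_logdet_le0 phiP QP Mpd Qpd.
rewrite (sum_logdet_pdmx Qpd) (sum_logdet_pdmx Mpd) -EFinN lee_fin; lra.
Qed.

(** Finiteness of the common value excludes singular matrices and puts [sum_logdet_le0] in its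
    equality case. Applied against one known optimum, this yields uniqueness on the other side. *)
Lemma duality_eq {phi Q} {r : R} : primal_feasible G phi -> dual_feasible Q ->
  primal_obj G phi = r%:E -> dual_obj Q = r%:E ->
  (forall h : truncG G t, pdmx (locmx phi (val h))) /\
  forall h : truncG G t, Q h = invmx (locmx phi (val h)).
Proof.
move=> phiP QP; have [_ Mpsd] := phiP; have [Qpsd _] := QP.
rewrite /dual_obj /primal_obj.
have [Qpd|nQ] := pselect (forall h, pdmx (Q h)); last first.
  by rewrite (sum_logdet_singular Qpsd nQ).
have [Mpd|nM] := pselect (forall h : truncG G t, pdmx (locmx phi (val h))); last first.
  by rewrite (sum_logdet_singular Mpsd nM).
rewrite (sum_logdet_pdmx Qpd) (sum_logdet_pdmx Mpd) -EFinN => -[Mr] [Qr].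
split=> //; have [_] := sum_logdet_le0 phiP QP Mpd Qpd; apply; lra.
Qed.

(** The polynomial identity is the stationarity condition; it also says that the inverses of the
    localizing matrices satisfy the dual constraint. *)
Definition kkt_point phi : Prop :=
  [/\ primal_feasible G phi, forall h : truncG G t, pdmx (locmx phi (val h)) &
    \sum_(h : truncG G t) val h * gram (invmx (locmx phi (val h)))
      = mpolyC n (total_size G t)%:R].

(** The inverse matrices are dual feasible with the same objective value [r] as [phi], so weak
    duality makes both optimal. *)
Lemma kkt_optimal {phi} : kkt_point phi -> 1 \in truncG G t ->
  let Q : gram_family G t := fun h => invmx (locmx phi (val h)) in
  exists r : R, [/\ rho G t = r%:E /\ rho_star G t = r%:E,
    primal_optimal G phi, dual_optimal Q,
    (forall phi', primal_optimal G phi' -> phi' = phi) &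
    (forall Q', dual_optimal Q' -> Q' = Q)].
Proof.
move=> [phiP Mpd ME] G1 Q; have Qpd h : pdmx (Q h) by apply: pdmx_inv.
have QP : dual_feasible Q.
  split=> [h|x]; first exact: pdmx_psd.
  rewrite -(mevalC (fun i => x 0 i) (total_size G t)%:R) -ME raddf_sum.
  by apply: eq_bigr => h _ /=; rewrite mevalM -!/(peval _ _) peval_gram.
pose r : R := \sum_h ln (\det (Q h)).
have Qr : dual_obj Q = r%:E by apply: sum_logdet_pdmx.
have phir : primal_obj G phi = r%:E.
  rewrite /primal_obj (sum_logdet_pdmx Mpd) -EFinN -sumrN; congr (_%:E).
  by apply: eq_bigr => h _; rewrite det_inv lnV // posrE pdmx_det_gt0.
have rhoE : rho G t = r%:E.
  apply/eqP; rewrite eq_le; apply/andP; split.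
    by apply: ereal_inf_lbound; exists phi.
  by apply: le_ereal_inf_tmp => _ [phi' phi'P <-]; rewrite -Qr weak_duality.
have rho_starE : rho_star G t = r%:E.
  apply/eqP; rewrite eq_le; apply/andP; split; last first.
    by apply: ereal_sup_ubound; exists Q.
  by apply: ge_ereal_sup => _ [Q' Q'P <-]; rewrite -phir weak_duality.
exists r; split=> //.
- by split; rewrite ?rhoE.
- by split; rewrite ?rho_starE.
- move=> phi' [phi'P]; rewrite rhoE => phi'r.
  (* Another optimum has the same inverse localizing matrix for [g = 1], which determines all its
     moments. *)
  have [M'pd /(_ [` G1]%fset)] := duality_eq phi'P QP phi'r Qr.
  by rewrite /Q => /(can_inj invmxK) /= /esym/locmx1_inj.
- move=> Q' [Q'P]; rewrite rho_starE => Q'r.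
  have [_ H] := duality_eq phiP Q'P phir Q'r.
  exact: functional_extensionality_dep.
Qed.

End Duality.

(** * Existence of a Karush-Kuhn-Tucker point *)

Section Interior.
Context {R : realType} {n : nat} {G : {fset {mpoly R[n]}}} {t : nat}.
Context (G1 : 1 \in truncG G t).
Implicit Types (phi : 'rV[R]_(nmonom n (2 * t))) (p : {mpoly R[n]}).

Let h1 : truncG G t := [` G1]%fset.

Lemma poly_of_coefs1 (d : nat) :
  poly_of_coefs (\row_(i < nmonom n d) (1 : {mpoly R[n]})@_(expo i)) = 1.
Proof. by rewrite poly_of_coefsK // msize1. Qed.

Lemma total_size_gt0 : 0 < (total_size G t)%:R :> R.
Proof.
rewrite ltr0n /total_size (bigD1 h1) //= addn_gt0; apply/orP; left.
by apply/card_gt0P; exists (BMultinom (bm0_proof n _)).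
Qed.

Lemma sos_sum {I : finType} (P : pred I) (f : I -> {mpoly R[n]}) :
  (forall i, sos (f i)) -> sos (\sum_(i | P i) f i).
Proof.
move=> fsos; elim/big_ind: _ => // [|_ _ [ps ->] [qs ->]].
  by exists [::]; rewrite big_nil.
by exists (ps ++ qs); rewrite big_cat.
Qed.

Lemma msize_gram_mul (h : {mpoly R[n]}) (Q : 'M[R]_(msz t h)) : (halfdeg h <= t)%N ->
  (msize (gram Q * h) <= (2 * t).+1)%N.
Proof.
move=> ht; move: (gram Q) (msize_gram Q) => q szq.
have [->|q0] := eqVneq q 0; first by rewrite mul0r msize0.
have [->|h0] := eqVneq h 0; first by rewrite mulr0 msize0.
rewrite msizeM //.
have arith (a b : nat) : (a <= (2 * (t - uphalf b.-1)).+1 -> uphalf b.-1 <= t ->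
  (a + b).-1 <= (2 * t).+1)%N by rewrite uphalfE; lia.
exact: arith szq ht.
Qed.

Lemma in_truncG (h : truncG G t) : (val h \in G) && (halfdeg (val h) <= t)%N.
Proof. have : fsval h \in truncG G t by apply: fsvalP.
by rewrite !inE. Qed.

Lemma qmodule_gram (Q : gram_family G t) : (forall h, pdmx (Q h)) ->
  qmodule G t (\sum_(h : truncG G t) val h * gram (Q h)).
Proof.
move=> Qpd.
(* The filtered sum extends the family from [truncG G t] to [G]: it has a single term when [g] lies
   in [truncG G t] and is empty otherwise. *)
exists (fun g : G => \sum_(h : truncG G t | val h == val g) gram (Q h)).
split=> [g|].
  split; first by apply: sos_sum => h; apply: sos_gram (Qpd h).
  rewrite mulr_suml; apply: leq_trans (msize_sum _ _ _) _.
  apply/bigmax_leqP_seq => h _ /eqP <-; apply: msize_gram_mul.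
  by case/andP: (in_truncG h).
under [RHS]eq_bigr do rewrite mulr_suml.
rewrite (exchange_big_dep predT) //=; apply: eq_bigr => h _.
have hG : val h \in G by case/andP: (in_truncG h).
rewrite (bigD1 [` hG]%fset) //= big1 ?addr0 1?mulrC // => g /andP[/eqP hg].
by move=> /negP[]; apply/eqP/val_inj; rewrite /= -hg.
Qed.

(** In [N * p = N + N * (p - 1)] the dual identity represents [N], and a small Hankel matrix added
    to the Gram matrix of [g = 1] absorbs [N * (p - 1)]. *)
Lemma interior_of_pd_dual {Q : gram_family G t} : dual_feasible Q ->
  (forall h, pdmx (Q h)) -> interior_deg (2 * t) (qmodule G t) 1.
Proof.
move=> QP Qpd; exists (\row_i (1 : {mpoly R[n]})@_(expo i)); last first.
  exact: poly_of_coefs1.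
set c1 := \row_i _; have c1E : poly_of_coefs c1 = 1 by apply: poly_of_coefs1.
have [e e0 Qe] := pdmx_perturb (Qpd h1).
have N0 := total_size_gt0; set N := _%:R in N0.
(* The coefficients of [p - 1] get multiplied by [N], and the perturbation must stay within [e]. *)
apply/nbhs_ballP; exists (e / N) => /=; first exact: divr_gt0.
move=> c cc1 /=; set p := poly_of_coefs c.
pose E : 'M[R]_(msz t (val h1)) := hankel _ (N *: (p - 1)).
have msize_p : (msize (N *: (p - 1)) <= (2 * t).+1)%N.
  apply: leq_trans (msizeZ_le _ _) _; rewrite -c1E.
  apply: leq_trans (msizeD_le _ _) _.
  by rewrite msizeN geq_max !msize_poly_of_coefs.
have E_le i j : `|E i j| <= e.
  apply: le_trans (hankel_le _ _ _ _) _; set m := mnm_add _ _.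
  have /expo_surj[k <-] : (mdeg m <= 2 * t)%N.
    rewrite mdegD mul2n -addnn.
    by rewrite leq_add // (leq_trans (mdeg_expo _)) // leq_subr.
  rewrite mcoeffZ -c1E mcoeffB !mcoeff_poly_of_coefs.
  rewrite normrM gtr0_norm // mulrC -ler_pdivlMr // distrC.
  exact: ltW (cc1.2 0 k).
pose Q' : gram_family G t := fun h =>
  N^-1 *: (Q h + (if h == h1 then hankel _ (N *: (p - 1)) else 0)).
have Q'pd h : pdmx (Q' h).
  apply: pdmxZ; first by rewrite invr_gt0.
  case: eqVneq => [->|_]; last by rewrite addr0.
  by apply: Qe => //; apply: hankel_sym.
suff -> : p = \sum_(h : truncG G t) val h * gram (Q' h) by apply: qmodule_gram.
under eq_bigr do rewrite gramZ gramD -scalerAr mulrDr.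
rewrite -scaler_sumr big_split /= (dual_gram QP) -/N.
rewrite (bigD1 h1) //= eqxx mul1r gram_hankel; last first.
  by rewrite /halfdeg /mdegree msize1 subn0.
rewrite big1 ?addr0 => [|h /negPf->]; last by rewrite gram0 mulr0.
rewrite scalerDr scalerA mulVf ?gt_eqF // scale1r.
rewrite -[mpolyC n N]mulr1 mul_mpolyC scalerA mulVf ?gt_eqF // scale1r.
by rewrite addrC subrK.
Qed.

(** Adding a multiple [s] of a monomial to [1] stays in the quadratic module for [|s| < e], so
    [1 + s * phi 0 i >= 0]; the choices [s = e / 2] and [s = - e / 2] bound the moment. *)
Lemma feasible_bounded : 0 \notin G -> interior_deg (2 * t) (qmodule G t) 1 ->
  exists B : R, forall phi, primal_feasible G phi -> forall i, `|phi 0 i| <= B.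
Proof.
move=> G0 [c /nbhs_ballP[e /= e0 ce] c1]; exists (2 / e) => phi [phi1 Mpsd] i.
have H s : `|s| < e -> 0 <= 1 + s * phi 0 i.
  move=> se; have : qmodule G t (poly_of_coefs (c + s *: delta_mx 0 i)).
    apply: ce; split=> // a b; rewrite /ball /= !mxE opprD addNKr normrN normrM.
    case: (_ && _); rewrite ?normr1 ?normr0 ?mulr1 ?mulr0 //.
  move=> /(riesz_qmodule_ge0 _ _ _ G0 Mpsd).
  rewrite riesz_poly_of_coefs; congr (_ <= _).
  under eq_bigr do rewrite !mxE eqxx mulrDl /=.
  rewrite big_split /= -riesz_poly_of_coefs c1 phi1; congr (_ + _).
  rewrite (bigD1 i) //= eqxx mulr1 big1 ?addr0 // => j /negPf->.
  by rewrite mulr0 mul0r.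
have e2 : `|e / 2| < e by rewrite gtr0_norm ?divr_gt0 // ltr_pdivrMr //; lra.
have H1 := H _ e2; have := H (- (e / 2)); rewrite normrN => /(_ e2) H2.
rewrite ler_norml -mulNr ler_pdivrMr // ler_pdivlMr //; lra.
Qed.

End Interior.

(** * Compactness of the feasible set and a strictly feasible point *)

Section Existence.
Context {R : realType} {n : nat} {G : {fset {mpoly R[n]}}} {t : nat}.
Implicit Types (phi psi : 'rV[R]_(nmonom n (2 * t))) (p : {mpoly R[n]}).

Lemma sum_continuous {T : topologicalType} {I : finType} (f : I -> T -> R) :
  (forall i, continuous (f i)) -> continuous (fun x => \sum_i f i x).
Proof.
move=> fc; apply: continuous_big => //.
by move=> u; apply: cvgD; [apply: cvg_fst | apply: cvg_snd].
Qed.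

Lemma prod_continuous {T : topologicalType} {I : finType} (f : I -> T -> R) :
  (forall i, continuous (f i)) -> continuous (fun x => \prod_i f i x).
Proof.
move=> fc; apply: continuous_big => //.
by move=> u; apply: cvgM; [apply: cvg_fst | apply: cvg_snd].
Qed.

Lemma scale_continuous {T : topologicalType} c (f : T -> R) :
  continuous f -> continuous (fun x => c * f x).
Proof. by move=> fc x; apply: cvgM; [apply: cvg_cst | apply: fc]. Qed.

Lemma riesz_continuous {d} p :
  continuous (fun phi : 'rV[R]_(nmonom n d) => riesz phi p).
Proof.
apply: (@sum_continuous _ _ (fun i (phi : 'rV_ _) => p@_(expo i) * phi 0 i)).
by move=> i; apply: scale_continuous; apply: coord_continuous.
Qed.

Lemma riesz_closed {d} p (D : set R) : closed D ->
  closed [set phi : 'rV[R]_(nmonom n d) | D (riesz phi p)].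
Proof.
by move: D; apply/continuous_closedP/riesz_continuous.
Qed.

Lemma det_continuous {T : topologicalType} {k} (A : T -> 'M[R]_k) :
  (forall i j, continuous (fun x => A x i j)) -> continuous (fun x => \det (A x)).
Proof.
move=> Ac.
apply: (@sum_continuous _ _ (fun (s : 'S_k) x => (-1) ^+ s * \prod_i A x i (s i))).
by move=> s; apply: scale_continuous; apply: prod_continuous.
Qed.

Lemma locmx_det_continuous p :
  continuous (fun phi => \det (locmx phi p)).
Proof.
apply: det_continuous => i j.
under eq_fun do rewrite mxE; exact: riesz_continuous.
Qed.

Lemma feasible_closed : closed (@primal_feasible R n G t).
Proof.
have -> : @primal_feasible R n G t =
    [set phi | riesz phi 1 = 1] `&`
    \bigcap_(u in [set: {h : truncG G t & 'cV[R]_(msz t (val h))}])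
      [set phi | 0 <= qform (locmx phi (val (tag u))) (tagged u)].
  apply/seteqP; split=> phi [phi1 phiP]; split=> //.
    by move=> [h v] _ /=; case: (phiP h) => _; apply.
  move=> h; split=> [|v]; first exact: locmx_sym.
  exact: (phiP (Tagged (fun h : truncG G t => 'cV[R]_(msz t (val h))) v)).
apply: closedI; first exact: (riesz_closed 1 [set x | x = 1] (closed_eq (y := 1))).
apply: closed_bigI => u _; under eq_set do rewrite qform_locmx.
exact: (riesz_closed _ [set x | 0 <= x] (closed_ge (y := 0))).
Qed.

Lemma feasible_compact : 0 \notin G -> interior_deg (2 * t) (qmodule G t) 1 ->
  compact (@primal_feasible R n G t).
Proof.
move=> G0 /(feasible_bounded G0)[B phiB]; apply: bounded_closed_compact.
  exists `|B|; split; first exact: num_real.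
  move=> M BM phi phiP /=; rewrite [leLHS]/Num.norm /= mx_normrE.
  apply: bigmax_le => [|[i j] _ /=]; first exact: le_trans (ltW BM).
  by rewrite ord1 (le_trans (phiB _ phiP j)) // (le_trans (ler_norm _)) // ltW.
exact: feasible_closed.
Qed.

(** Averages the evaluations at unisolvent points near [x]. Each quadratic form is then an average
    of the values of [h * q ^+ 2]; if it were zero, [h * q] would vanish at all the points and hence
    be zero. *)
Lemma strictly_feasible (x : 'rV[R]_n) (e : R) : 0 < e -> 0 \notin G ->
  (forall (y : 'rV[R]_n) h, (forall i, `|x 0 i - y 0 i| < e) -> h \in G -> 0 <= peval h y) ->
  exists phi, primal_feasible G phi /\
    forall h : truncG G t, pdmx (locmx phi (val h)).
Proof.
move=> e0 G0 Gpos; have [k [y [yx yP]]] := unisolvent_points x e (2 * t) e0.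
(* An empty family of points would make the polynomial [1] zero. *)
have k0 : (0 < k)%N.
  case: k y yx yP => // y _ /(_ 1); rewrite msize1 => /(_ isT) y1.
  by have /eqP := y1 (fun j : 'I_0 => False_ind _ (notF (ltn_ord j)));
    rewrite oner_eq0.
have kR : 0 < k%:R^-1 :> R by rewrite invr_gt0 ltr0n.
pose phi : 'rV[R]_(nmonom n (2 * t)) :=
  \row_i (k%:R^-1 * \sum_j peval (mpolyX R (expo i)) (y j)).
have phiE p : (msize p <= (2 * t).+1)%N ->
    riesz phi p = k%:R^-1 * \sum_j peval p (y j).
  move=> /poly_of_coefsK<-; set c := \row__ _.
  rewrite riesz_poly_of_coefs; under eq_bigr do rewrite [phi 0 _]mxE mulrCA mulr_sumr.
  rewrite -mulr_sumr exchange_big; congr (_ * _); apply: eq_bigr => j _.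
  rewrite /peval /poly_of_coefs raddf_sum; apply: eq_bigr => i _.
  by rewrite /= mevalZ.
have phi1 : riesz phi 1 = 1.
  rewrite phiE ?msize1 //; under eq_bigr do rewrite /peval meval1.
  by rewrite sumr_const card_ord mulVf // pnatr_eq0 -lt0n.
have Mpd (h : truncG G t) : pdmx (locmx phi (val h)).
  split=> [|v v0]; first exact: locmx_sym.
  have /andP[hG ht] := in_truncG h.
  have h0 : val h != 0 by apply: contraNneq G0 => <-.
  set q := poly_of_coefs v^T; have q0 : q != 0.
    apply: contra_neq v0 => q0; apply/colP => i.
    by have := mcoeff_poly_of_coefs v^T i; rewrite -/q q0 mcoeff0 !mxE.
  have qf : qform (locmx phi (val h)) v =
      k%:R^-1 * \sum_j peval (val h) (y j) * peval q (y j) ^+ 2.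
    rewrite qform_locmx phiE -/q.
      congr (_ * _); apply: eq_bigr => j _; rewrite /peval mevalM rmorphXn //.
    by rewrite /q -gram_outer mulrC; apply: msize_gram_mul.
  have ge0 j : 0 <= peval (val h) (y j) * peval q (y j) ^+ 2.
    by rewrite mulr_ge0 ?sqr_ge0 // Gpos.
  rewrite qf pmulr_rgt0 // lt_neqAle sumr_ge0 // andbT eq_sym.
  rewrite psumr_neq0 //; apply: contraT => /hasPn hq.
  have : val h * q = 0.
    apply: yP => [|j].
      have sq : (msize q <= (t - halfdeg (val h)).+1)%N.
        exact: msize_poly_of_coefs.
      rewrite msizeM //; move: sq ht; rewrite /halfdeg /mdegree.
      have arith (a b : nat) : (a <= (t - uphalf b.-1).+1 -> uphalf b.-1 <= t ->
        (b + a).-1 <= (2 * t).+1)%N by rewrite uphalfE; lia.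
      exact: arith.
    have := hq j (mem_index_enum _); rewrite /= lt_neqAle ge0 andbT negbK eq_sym.
    rewrite mulf_eq0 sqrf_eq0 -mulf_eq0 => /eqP.
    by rewrite /peval mevalM.
  by move/eqP; rewrite mulf_eq0 (negPf h0) (negPf q0).
exists phi; split=> //; split=> // h; exact: pdmx_psd.
Qed.

(** A nonzero coefficient of degree one dominates the remainder near zero, and an [s] of the same
    sign would push the value above [1]. *)
Lemma coef1_local_max (p : {poly R}) (e : R) : 0 < e -> p`_0 = 1 ->
  (forall s, `|s| <= e -> p.[s] <= 1) -> p`_1 = 0.
Proof.
move=> e0 p0 pmax; pose q := drop_poly 2 p.
have pE s : p.[s] = 1 + s * (p`_1 + s * q.[s]).
  rewrite -[p in LHS](poly_take_drop 2) hornerD hornerM hornerXn -/q.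
  rewrite horner_poly big_ord_recl big_ord1 /= p0; ring.
have [B qB] := poly_disk_bound q e.
have B0 : 0 <= B by apply: le_trans (qB 0 _); rewrite ?normr0 // ltW.
apply/eqP; apply: contraT; rewrite -normr_gt0 => p1.
(* The first bound keeps [|s| <= e]; the second makes [d * |q.[s]|] smaller than the coefficient of
   degree one. *)
pose d := Num.min e (`|p`_1| / (2 * (B + 1))).
have B1 : 0 < 2 * (B + 1) by lra.
have d0 : 0 < d by rewrite lt_min e0 divr_gt0.
have de : d <= e by rewrite ge_min lexx.
have dB : d * (2 * (B + 1)) <= `|p`_1|.
  by rewrite -ler_pdivlMr // ge_min lexx orbT.
pose s := Num.sg p`_1 * d.
have s_norm : `|s| = d.
  by rewrite normrM normr_sg -normr_gt0 p1 mul1r gtr0_norm.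
have := pmax s; rewrite s_norm => /(_ de); rewrite pE gerDl.
have := qB s; rewrite s_norm => /(_ de); rewrite ler_norml => /andP[qs1 qs2].
have -> : s * (p`_1 + s * q.[s]) = d * (`|p`_1| + d * q.[s]).
  have sg2 : Num.sg p`_1 * Num.sg p`_1 = 1.
    by rewrite -expr2 sqr_sg -normr_gt0 p1.
  have p1E : `|p`_1| = Num.sg p`_1 * p`_1 by rewrite normrEsg.
  by rewrite p1E -[d * q.[s]]mul1r -sg2 {1 2}/s; ring.
rewrite pmulr_rle0 //; nra.
Qed.

End Existence.

(** * Stationarity at a maximizer of the product of determinants *)

Section Optimality.
Context {R : realType} {n : nat} {G : {fset {mpoly R[n]}}} {t : nat}.
Implicit Types (phi psi : 'rV[R]_(nmonom n (2 * t))) (p : {mpoly R[n]}).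

Lemma pdmx_line {k} {A B : 'M[R]_k} : pdmx A -> B^T = B ->
  exists e : R, 0 < e /\ forall s, `|s| <= e -> pdmx (A + s *: B).
Proof.
move=> Apd Bs; have [e e0 Ae] := pdmx_perturb Apd.
pose b := \sum_i \sum_j `|B i j|.
have b0 : 0 <= b by apply: sumr_ge0 => i _; apply: sumr_ge0.
have b1 : 0 < 1 + b by rewrite ltr_wpDr.
exists (e / (1 + b)); split=> [|s]; first exact: divr_gt0.
rewrite ler_pdivlMr // => sb; apply: Ae => [|i j]; first by rewrite linearZ /= Bs.
have Bb : `|B i j| <= b.
  rewrite /b (bigD1 i) //= (bigD1 j) //= -addrA lerDl.
  by rewrite addr_ge0 ?sumr_ge0 // => a _; apply: sumr_ge0.
rewrite mxE normrM; apply: le_trans sb; rewrite ler_wpM2l //.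
by apply: le_trans Bb _; rewrite lerDr.
Qed.

Lemma uniform_radius {I : finType} (P : I -> R -> Prop) :
  (forall i, exists e : R, 0 < e /\ forall s, `|s| <= e -> P i s) ->
  exists2 e : R, 0 < e & forall i s, `|s| <= e -> P i s.
Proof.
move=> /choice[e eP]; exists (\big[Num.min/1]_i e i).
  by apply: lt_bigmin => // i _; case: (eP i).
by move=> i s se; case: (eP i) => _; apply; apply: le_trans se _; apply: bigmin_le_cond.
Qed.

Lemma coef01_prod {I : finType} (p : I -> {poly R}) (c : I -> R) :
  (forall i, (p i)`_0 = 1) -> (forall i, (p i)`_1 = c i) ->
  (\prod_i p i)`_0 = 1 /\ (\prod_i p i)`_1 = \sum_i c i.
Proof.
move=> p0 p1; elim/big_ind2: _ => [|q a r b [q0 q1] [r0 r1]|i _]; last by split.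
  by rewrite !coef1.
by rewrite !coefM big_ord1 !big_ord_recl big_ord0 /= q0 q1 r0 r1; split; ring.
Qed.

Lemma kkt_exists : 0 \notin G -> interior_deg (2 * t) (qmodule G t) 1 ->
  (exists phi, primal_feasible G phi /\
    forall h : truncG G t, pdmx (locmx phi (val h))) ->
  exists phi, kkt_point (G := G) phi.
Proof.
move=> G0 intQ [phi0 [phi0P M0pd]].
(* The product of determinants, unlike the sum of logarithms, is real and continuous at singular
   matrices too. *)
pose F phi := \prod_(h : truncG G t) \det (locmx phi (val h)).
have [] := @EVT_max_rV R _ F (@primal_feasible R n G t).
- by exists phi0.
- exact: feasible_compact.
- apply: continuous_subspaceT; apply: prod_continuous => h.
  exact: locmx_det_continuous.
move=> phi /set_mem phiP phi_max; have [phi1 Mpsd] := phiP.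
have Fphi : F phi != 0.
  rewrite gt_eqF //; apply: lt_le_trans (phi_max phi0 (mem_set phi0P)).
  by apply: prodr_gt0 => h _; apply: pdmx_det_gt0.
have Mpd (h : truncG G t) : pdmx (locmx phi (val h)).
  by apply: psdmx_pd => //; move/prodf_neq0: Fphi; apply.
set P := \sum_(h : truncG G t) val h * gram (invmx (locmx phi (val h))).
have rieszP psi : riesz psi P =
    \sum_(h : truncG G t) \tr (invmx (locmx phi (val h)) *m locmx psi (val h)).
  rewrite linear_sum; apply: eq_bigr => h _ /=.
  by rewrite -trace_locmx mxtrace_mulC.
(* Along [phi + s *: psi] the quotient of [F] by [F phi] is a polynomial in [s] with constant term
   [1] and coefficient of degree one [riesz psi P]. Small [s] stay feasible, so it is at most [1]
   near zero. *)
have critical psi : riesz psi 1 = 0 -> riesz psi P = 0.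
  move=> psi1; have [e e0 line_pd] := uniform_radius _ (fun h : truncG G t =>
    pdmx_line (Mpd h) (locmx_sym psi (val h))).
  have /choice[q qP] := fun h : truncG G t =>
    det_line_poly (invmx (locmx phi (val h)) *m locmx psi (val h)).
  have [q0 q1] : (\prod_h q h)`_0 = 1 /\ (\prod_h q h)`_1 = riesz psi P.
    by rewrite rieszP; apply: coef01_prod => h; case: (qP h).
  rewrite -q1; apply: coef1_local_max e0 q0 _ => s se.
  have : F (phi + s *: psi) <= F phi.
    apply: phi_max; apply/mem_set; split=> [|h].
      by rewrite rieszDl rieszZl psi1 mulr0 addr0.
    by rewrite locmxD locmxZ; apply/pdmx_psd/line_pd.
  have -> : F (phi + s *: psi) = F phi * (\prod_h q h).[s].
    rewrite horner_prod /F -big_split; apply: eq_bigr => h _ /=.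
    have [-> _ _] := qP h; rewrite -det_mulmx mulmxDr mulmx1 -scalemxAr mulmxA.
    by rewrite (mulmxV (pdmx_unit (Mpd h))) mul1mx locmxD locmxZ.
  rewrite ger_pMr // lt_neqAle eq_sym Fphi /=.
  by apply: prodr_ge0 => h _; apply: psdmx_det_ge0.
have szP : (msize P <= (2 * t).+1)%N.
  apply: leq_trans (msize_sum _ _ _) _; apply/bigmax_leqP_seq => h _ _.
  by rewrite mulrC; apply: msize_gram_mul; case/andP: (in_truncG h).
(* The coordinate directions other than that of the constant monomial are admissible for [critical],
   and each reads off one coefficient of [P]. *)
have PE : P = mpolyC n P@_mnm0.
  apply/mpolyP => m; rewrite mcoeffC; have [->|m0] := eqVneq m mnm0.
    by rewrite mulr1.
  rewrite mulr0; have [mt|mt] := leqP (mdeg m) (2 * t); last first.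
    by apply: memN_msupp_eq0; apply: msize_mdeg_ge; apply: leq_trans szP mt.
  have [i iE] := expo_surj _ mt; rewrite -iE in m0 *.
  rewrite -riesz_delta; apply: critical.
  by rewrite riesz_delta mcoeff1 (negPf m0).
exists phi; split=> //; rewrite -/P PE; congr (mpolyC n _).
(* Pairing [P] with [phi] itself computes the constant: each constraint contributes the trace of an
   identity matrix. *)
have := riesz_const phi P@_mnm0; rewrite -PE phi1 mulr1 => <-.
rewrite rieszP /total_size natr_sum; apply: eq_bigr => h _.
by rewrite mulVmx ?pdmx_unit // mxtrace1.
Qed.

End Optimality.

(** * Strong duality, unique optima and the resulting polynomial identity *)

Theorem theorem2p6 (R : realType) (n m : nat) (g : 'I_m -> {mpoly R[n]})
    (t : nat)
    (g_neq0 : forall j, g j != 0)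
    (S_compact : compact (semialg g))
    (S_interior : (semialg g)° !=set0) :
  let G := constraints g in
  let Gt := truncG G t in
  let N : R := (total_size G t)%:R in
  let one_interior := interior_deg (2 * t) (qmodule G t) 1 in
  ((exists r : R, rho G t = r%:E /\ rho_star G t = r%:E) <-> one_interior) /\
  (one_interior ->
    exists (phi : 'rV[R]_(nmonom n (2 * t))) (Q : gram_family G t),
      [/\ primal_optimal G phi /\
          (forall phi', primal_optimal G phi' -> phi' = phi),
          dual_optimal Q /\
          (forall Q' : gram_family G t, dual_optimal Q' -> Q' = Q),
          (forall h : Gt, pdmx (locmx phi (val h)) /\
                          Q h = invmx (locmx phi (val h))) &
          (forall x : 'rV[R]_n,
             1 = N^-1 * \sum_(h : Gt) peval (val h) x *
                   qform (invmx (locmx phi (val h))) (vmon t (val h) x) /\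
             1 = N^-1 * \sum_(h : Gt) peval (val h) x *
                   (christoffel phi (val h) x)^-1)]).
Proof.
move=> G Gt N one_interior.
have G0 : 0 \notin G.
  rewrite in_fset1U negb_or eq_sym oner_eq0 /=.
  by apply/imfsetP => -[j _ gj]; have := g_neq0 j; rewrite -gj eqxx.
have G1 : 1 \in Gt.
  have : 1 \in G by rewrite fset1U1.
  by rewrite /Gt; move: (G) => H H1; rewrite !inE H1 /halfdeg /mdegree msize1.
have N0 : N != 0 by rewrite gt_eqF // total_size_gt0.
(* A ball inside the semialgebraic set supplies the nonnegativity on which [strictly_feasible]
   relies. *)
have [x /nbhs_ballP[e /= e0 xS]] := S_interior.
have Gpos (y : 'rV[R]_n) h : (forall i, `|x 0 i - y 0 i| < e) -> h \in G ->
    0 <= peval h y.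
  move=> xy; rewrite in_fset1U => /predU1P[->|/imfsetP[j _ ->]].
    by rewrite /peval meval1.
  by apply: (xS y); split=> // i k; rewrite ord1; apply: xy.
have kkt := fun intQ : one_interior =>
  kkt_exists G0 intQ (strictly_feasible x e e0 G0 Gpos).
split; [split=> [[r [_ rE]]|/kkt[phi phiP]]|move=> /kkt[phi phiP]].
- have [[Q [QP Qpd]]|nQ] := pselect (exists Q : gram_family G t,
      dual_feasible Q /\ forall h, pdmx (Q h)).
    by have := interior_of_pd_dual G1 QP Qpd.
  (* Without a positive definite dual family every dual objective is [-oo], contradicting the finite
     value of [rho_star]. *)
  have : (rho_star G t <= -oo)%E.
    apply: ge_ereal_sup => _ [Q QP <-]; have [Qpsd _] := QP.
    rewrite /dual_obj sum_logdet_singular // => Qpd.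
    by apply: nQ; exists Q.
  by rewrite rE.
- by have [r [rE _ _ _ _]] := kkt_optimal phiP G1; exists r.
- have [r [_ phi_opt Q_opt phi_uniq Q_uniq]] := kkt_optimal phiP G1.
  exists phi; eexists; split; [by split|by split; [exact: Q_opt|]| |].
    by move=> h; split=> //; case: phiP => _ + _; apply.
  move=> y; have [[_ /(_ y) QN] _] := Q_opt.
  have H : 1 = N^-1 * \sum_(h : Gt) peval (val h) y *
                  qform (invmx (locmx phi (val h))) (vmon t (val h) y).
    by rewrite -QN mulVf.
  split=> //; rewrite {1}H; congr (_ * _); apply: eq_bigr => h _.
  by rewrite /christoffel invrK.
Qed.
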